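(* Let $(\mathsf X,d)$ be a Polish space and let $\phi:\mathscr P_1(\mathsf X)\to\bar{\mathbb R}$ be convex and lower semicontinuous with respect to $W_1$, with $\phi(\mu)>-\infty$ for all $\mu\in\mathscr P_1(\mathsf X)$ and $\phi(\mu_0)\in\mathbb R$ for some $\mu_0\in\mathscr P_1(\mathsf X)$. Let $\rho(f):=\sup_{\mu\in\mathscr P_1(\mathsf X)}\left(\int f\,d\mu-\phi(\mu)\right)$ for $f\in\mathscr L(\mathsf X)$, and $$\mathcal N_\phi:=\{f\in\mathscr L(\mathsf X):\rho(f)=0\},\qquad \bar{\mathcal N}_\phi:=\{f\in\mathscr L(\mathsf X):\rho(f)\le0\}.$$ Then for every $\mu\in\mathscr P_1(\mathsf X)$, $$\phi(\mu)=\sup_{f\in\mathcal N_\phi}\int f\,d\mu=\sup_{f\in\bar{\mathcal N}_\phi}\int f\,d\mu.$$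
   Context: A Polish space $(\mathsf X,d)$ is a complete separable metric space. $\bar{\mathbb R}=[-\infty,+\infty]$. $\mathscr P_1(\mathsf X)$ is the set of Borel probability measures $\mu$ on $\mathsf X$ with $\int d(x_0,x)\,\mu(dx)<\infty$ for an arbitrary $x_0\in\mathsf X$, with the Wasserstein-1 metric $W_1(\mu,\nu)=\inf\{\mathbb E[d(X,Y)]:\mathrm{law}(X)=\mu,\ \mathrm{law}(Y)=\nu\}$. $\mathscr L(\mathsf X)$ is the space of all real-valued Lipschitz functions on $(\mathsf X,d)$. *)

(* Defs.v *)
From HB Require Import structures.
From mathcomp Require Import all_boot all_order all_algebra.
From mathcomp Require Import all_classical all_reals all_analysis.

Set Implicit Arguments.
Unset Strict Implicit.
Unset Printing Implicit Defensive.

Import Order.TTheory GRing.Theory Num.Theory.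

Local Open Scope classical_set_scope.
Local Open Scope ring_scope.

(* Completeness in the library presupposes a distinguished point; this only
   excludes the empty space, which carries no probability measure. *)
#[short(type="completeMetricType")]
HB.structure Definition CompleteMetric (R : numDomainType) :=
  { T of Complete T & Metric R T }.

Definition separable (T : topologicalType) : Prop :=
  exists2 D : set T, countable D & dense D.

Section WassersteinSpace.
Variables (R : realType) (X : completeMetricType R).

Definition borel := g_sigma_algebraType (@open X).

Record P1 := MkP1 {
  P1_prob :> probability borel R ;
  P1_moment : forall x0 : X,
    (\int[P1_prob]_x (mdist x0 (x : X))%:E < +oo)%E }.

(* A [probability] is a function on all subsets, constrained only on the
   measurable ones: laws (here) and mixtures (below) are therefore compared on
   Borel sets only.  Two representatives of one Borel measure are at [W1]
   distance 0, hence a [W1]-lower semicontinuous function cannot separate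
   them. *)
Definition has_law (d : measure_display) (Omega : measurableType d)
    (P : probability Omega R) (Y : {RV P >-> borel}) (mu : P1) : Prop :=
  forall A : set borel, measurable A -> distribution P Y A = mu A.

Definition W1 (mu nu : P1) : \bar R :=
  ereal_inf [set c : \bar R |
    exists (d : measure_display) (Omega : measurableType d)
      (P : probability Omega R) (Y Z : {RV P >-> borel}),
      [/\ has_law Y mu, has_law Z nu &
          c = (\int[P]_w (mdist (Y w : X) (Z w : X))%:E)%E]].

Definition W1_lower_semicontinuous (phi : P1 -> \bar R) : Prop :=
  forall (mu : P1) (a : R), (a%:E < phi mu)%E ->
    exists2 e : R, 0 < e &
      forall nu : P1, (W1 mu nu < e%:E)%E -> (a%:E < phi nu)%E.

Definition is_mixture (t : R) (mu nu tau : P1) : Prop :=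
  forall A : set borel, measurable A ->
    (tau A = t%:E * mu A + (1 - t)%:E * nu A)%E.

Definition P1_convex (phi : P1 -> \bar R) : Prop :=
  forall (t : R) (mu nu tau : P1), 0 <= t <= 1 -> is_mixture t mu nu tau ->
    (phi tau <= t%:E * phi mu + (1 - t)%:E * phi nu)%E.

Definition Lip : set (X -> R) :=
  [set f | exists L : R, forall x y : X, `|f x - f y| <= L * mdist x y].

Definition rho (phi : P1 -> \bar R) (f : X -> R) : \bar R :=
  ereal_sup [set (\int[mu]_x (f x)%:E - phi mu)%E | mu in [set: P1]].

Definition calN (phi : P1 -> \bar R) : set (X -> R) :=
  [set f | Lip f /\ rho phi f = 0%E].

Definition calNbar (phi : P1 -> \bar R) : set (X -> R) :=
  [set f | Lip f /\ (rho phi f <= 0)%E].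

End WassersteinSpace.

(* Main.v *)
Require Import Defs.
From HB Require Import structures.
From mathcomp Require Import all_boot all_order all_algebra.
From mathcomp Require Import all_classical all_reals all_analysis.
From mathcomp Require Import measurable_realfun.
From mathcomp Require Import ring lra.

(** This is Fenchel-Moreau duality for the pairing of probability measures with
    Lipschitz functions.  A function [f] of [calNbar phi] satisfies
    [int f dnu <= phi nu] for all [nu], so both suprema are at most [phi mu].
    For the converse, given a real [a < phi mu], one needs a Lipschitz [f] with
    [int f dnu <= phi nu] for all [nu] and [a <= int f dmu]; subtracting the
    nonpositive constant [rho f] then places it in [calN phi].

    Two facts carry the proof, and both come from one minimax principle
    ([mean_exists]): if every function of a convex family of bounded functions on
    a set [S] has nonnegative supremum, then a single finitely additive mean on
    [S] is nonnegative on the whole family.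

    The first is Kantorovich-Rubinstein duality ([W1_le_kr]): [W1 mu nu] is at
    most [kr mu nu], the supremum of [int f dmu - int f dnu] over 1-Lipschitz [f].
    With [S = X * X], the principle produces a finitely additive transport plan
    whose cost is at most [kr mu nu]; along a countable partition of small mesh it
    becomes a matrix with the right row and column sums, because its marginals
    are countably additive, and the matrix is refined to a true coupling.
    Consequently [phi] is lower semicontinuous for [kr].

    The second is the existence of minorants ([affine_minorant]): if
    [a - K kr mu nu <= phi nu] for all [nu], then the required [f] exists.  With
    [S] the set of 1-Lipschitz functions vanishing at a base point, the principle
    produces a mean of such functions.  Its pointwise barycenter is 1-Lipschitz,
    and integration against a measure with finite first moment commutes with the
    barycenter, since it is a uniform limit of finite combinations of evaluations.

    It remains to bound [phi] below by [a - K kr mu nu].  Convexity and lower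
    semicontinuity at a point of the domain give a first Lipschitz minorant
    ([minorant_exists]), and that minorant controls [phi] far from an arbitrary
    [mu], while semicontinuity at [mu] controls it nearby ([minorant_near]). *)

Set Implicit Arguments.
Unset Strict Implicit.
Unset Printing Implicit Defensive.
Import Order.TTheory GRing.Theory Num.Theory.
Import numFieldNormedType.Exports.
Local Open Scope classical_set_scope.
Local Open Scope ring_scope.

(** * Finitely additive means and the minimax principle *)

Section means.
Variables (R : realType) (S : Type).
Implicit Types (f g h v : S -> R) (q m : (S -> R) -> R) (H : set (S -> R)).

Definition bounded_fct g := exists C : R, forall x, `|g x| <= C.

Lemma bounded_fctD f g : bounded_fct f -> bounded_fct g ->
  bounded_fct (fun x => f x + g x).
Proof.
move=> [C hC] [D hD]; exists (C + D) => x.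
by rewrite (le_trans (ler_normD _ _))// lerD.
Qed.

Lemma bounded_fctZ c f : bounded_fct f -> bounded_fct (fun x => c * f x).
Proof.
by move=> [C hC]; exists (`|c| * C) => x; rewrite normrM ler_wpM2l.
Qed.

Lemma bounded_fctN f : bounded_fct f -> bounded_fct (fun x => - f x).
Proof. by move=> [C hC]; exists C => x; rewrite normrN. Qed.

(** These are the functionals that Hahn-Banach starts from: sublinear on bounded
    functions and dominated by the supremum. *)
Definition sublinear_le_sup q := [/\
  forall f g, bounded_fct f -> bounded_fct g ->
    q (fun x => f x + g x) <= q f + q g,
  forall c f, 0 < c -> bounded_fct f -> q (fun x => c * f x) <= c * q f &
  forall f C, bounded_fct f -> (forall x, f x <= C) -> q f <= C].

(** A finitely additive probability on [S], given by its integral on bounded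
    functions. *)
Definition is_mean m := [/\
  forall f g, bounded_fct f -> bounded_fct g ->
    m (fun x => f x + g x) = m f + m g,
  forall c f, bounded_fct f -> m (fun x => c * f x) = c * m f &
  forall f C, bounded_fct f -> (forall x, f x <= C) -> m f <= C].

Lemma sublinear0 q : sublinear_le_sup q -> q (fun=> 0) = 0.
Proof.
move=> [_ qZ qs].
have b0 : bounded_fct (fun=> 0) by exists 0 => x; rewrite normr0.
have h1 : q (fun=> 0) <= 0 by exact: qs.
have := qZ 2 (fun=> 0) ltac:(lra) b0; rewrite mulr0; lra.
Qed.

Lemma sublinear_lbN q f : sublinear_le_sup q -> bounded_fct f ->
  - q (fun x => - f x) <= q f.
Proof.
move=> qsub bf; have q0 := sublinear0 qsub; case: qsub => qD _ _.
have := qD _ _ bf (bounded_fctN bf).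
have -> : (fun x => f x + - f x) = (fun=> 0).
  by apply/funext => x; rewrite subrr.
lra.
Qed.

Lemma sublinear_lb q f C : sublinear_le_sup q -> bounded_fct f ->
  (forall x, - C <= f x) -> - C <= q f.
Proof.
move=> qsub bf fC; apply: le_trans (sublinear_lbN qsub bf).
case: qsub => _ _ qs; rewrite lerN2 qs//; first exact: bounded_fctN.
by move=> x; rewrite lerNl.
Qed.

(** Zorn's lemma applies because the infimum of a chain is again such a
    functional; that infimum is finite since each member of the chain is at
    least [- C] on a function bounded below by [- C]. *)
Lemma minimal_sublinear q0 : sublinear_le_sup q0 ->
  exists2 q, sublinear_le_sup q /\ (forall f, bounded_fct f -> q f <= q0 f) &
    forall q', sublinear_le_sup q' ->
      (forall f, bounded_fct f -> q' f <= q f) ->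
      forall f, bounded_fct f -> q f <= q' f.
Proof.
move=> q0sub.
pose T := {q | sublinear_le_sup q /\ forall f, bounded_fct f -> q f <= q0 f}.
pose t0 : T := exist _ q0 (conj q0sub (fun f _ => lexx (q0 f))).
pose Rel (s t : T) := `[< forall f, bounded_fct f -> sval t f <= sval s f >].
have [| | |[q [qsub qq0]] qmax] := @ZL_preorder T t0 Rel.
- by move=> t; apply/asboolP.
- move=> r s t /asboolP rs /asboolP st; apply/asboolP => f bf.
  by rewrite (le_trans (st f bf))// rs.
- move=> A totA; have [A0|/set0P[t1 At1]] := eqVneq A set0.
    by exists t0 => s; rewrite A0.
  pose V f := [set sval t f | t in A].
  have lbV f : bounded_fct f -> has_lbound (V f).
    move=> [C fC]; exists (- C) => _ [t At <-].
    apply: (sublinear_lb (svalP t).1); first by exists C.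
    by move=> x; have := fC x; rewrite ler_norml => /andP[].
  have Vle f t : bounded_fct f -> A t -> inf (V f) <= sval t f.
    by move=> bf At; apply: ge_inf; [exact: lbV|exists t].
  have leV f c : (forall t, A t -> c <= sval t f) -> c <= inf (V f).
    move=> h; apply: lb_le_inf; first by exists (sval t1 f), t1.
    by move=> _ [t At <-]; exact: h.
  have subq : sublinear_le_sup (fun f => inf (V f)).
    split=> [f g bf bg|c f c0 bf|f C bf fC].
    + have bfg := bounded_fctD bf bg.
      rewrite -lerBlDr; apply: (leV) => t At; rewrite lerBlDr -lerBlDl.
      apply: (leV) => s As; rewrite lerBlDl.
      have [/asboolP st|/asboolP ts] := totA s t As At.
        have [qD _ _] := (svalP t).1.
        rewrite (le_trans (Vle _ t bfg At))// (le_trans (qD _ _ bf bg))//.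
        by rewrite lerD// st.
      have [qD _ _] := (svalP s).1.
      rewrite (le_trans (Vle _ s bfg As))// (le_trans (qD _ _ bf bg))//.
      by rewrite lerD// ts.
    + rewrite -ler_pdivrMl//; apply: (leV) => t At; rewrite ler_pdivrMl//.
      have [_ qZ _] := (svalP t).1.
      by rewrite (le_trans (Vle _ t _ At)) ?qZ//; exact: bounded_fctZ.
    + have [_ _ qs] := (svalP t1).1.
      by rewrite (le_trans (Vle _ t1 bf At1))// qs.
  have leq0 f : bounded_fct f -> inf (V f) <= q0 f.
    by move=> bf; rewrite (le_trans (Vle _ t1 bf At1))// (svalP t1).2.
  pose t : T := exist _ (fun f => inf (V f)) (conj subq leq0).
  exists t => s As; apply/asboolP => f bf.
  exact: Vle.
exists q => // q' q'sub q'q f bf.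
pose t' : T := exist _ q'
  (conj q'sub (fun f bf => le_trans (q'q f bf) (qq0 f bf))).
pose t : T := exist _ q (conj qsub qq0).
have /asboolP : Rel t' t by apply: qmax; apply/asboolP.
exact.
Qed.

Lemma sublinearZ q c f : sublinear_le_sup q -> 0 < c -> bounded_fct f ->
  q (fun x => c * f x) = c * q f.
Proof.
move=> [_ qZ _] c0 bf; apply/eqP; rewrite eq_le qZ//=.
have := qZ c^-1 (fun x => c * f x); rewrite invr_gt0 => /(_ c0 (bounded_fctZ c bf)).
have -> : (fun x => c^-1 * (c * f x)) = f.
  by apply/funext => x; rewrite mulKf ?gt_eqF.
by rewrite ler_pdivlMl.
Qed.

(** For each bounded [v] the functional
    [f |-> inf_(t >= 0) (q (f + t v) - t q v)] is sublinear and below [q], so it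
    equals [q] when [q] is minimal; at [t = 1] this reads
    [q f + q v <= q (f + v)], the missing half of additivity. *)
Lemma minimal_is_mean q : sublinear_le_sup q ->
  (forall q', sublinear_le_sup q' ->
     (forall f, bounded_fct f -> q' f <= q f) ->
     forall f, bounded_fct f -> q f <= q' f) ->
  is_mean q.
Proof.
move=> qsub qmin; have q0 := sublinear0 qsub; have [qD qZ qs] := qsub.
have qadd f v : bounded_fct f -> bounded_fct v ->
    q (fun x => f x + v x) = q f + q v.
  move=> bf bv; apply/eqP; rewrite eq_le qD//=.
  pose V f := [set q (fun x => f x + t * v x) - t * q v |
    t in [set t : R | 0 <= t]].
  have qZ0 t : 0 <= t -> q (fun x => t * v x) = t * q v.
    rewrite le_eqVlt => /predU1P[<-|t0]; last exact: sublinearZ.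
    rewrite mul0r -[RHS]q0; congr q.
    by apply/funext => x; rewrite mul0r.
  have lbV g : bounded_fct g -> has_lbound (V g).
    move=> bg; exists (- q (fun x => - g x)) => _ [t /= t0 <-].
    have btv := bounded_fctZ t bv.
    rewrite lerBrDr -qZ0// addrC lerBlDr.
    have -> : (fun x => t * v x) = (fun x => (g x + t * v x) + - g x).
      by apply/funext => x; ring.
    by apply: qD; [exact: bounded_fctD|exact: bounded_fctN].
  have Vle g t : bounded_fct g -> 0 <= t ->
      inf (V g) <= q (fun x => g x + t * v x) - t * q v.
    by move=> bg t0; apply: ge_inf; [exact: lbV|exists t].
  have leV g c : (forall t, 0 <= t ->
      c <= q (fun x => g x + t * v x) - t * q v) -> c <= inf (V g).
    move=> h; apply: lb_le_inf; last by move=> _ [t t0 <-]; exact: h.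
    by exists (q (fun x => g x + 0 * v x) - 0 * q v), 0 => /=.
  have Vq g : bounded_fct g -> inf (V g) <= q g.
    move=> bg; have := Vle g 0 bg (lexx 0); rewrite mul0r subr0.
    by under eq_fun do rewrite mul0r addr0.
  have Vsub : sublinear_le_sup (fun f => inf (V f)).
    split=> [g h bg bh|c g c0 bg|g C bg gC].
    + have bgh := bounded_fctD bg bh.
      rewrite -lerBlDr; apply: (leV) => t t0; rewrite lerBlDr -lerBlDl.
      apply: (leV) => s s0; rewrite lerBlDl.
      rewrite (le_trans (Vle _ (t + s) bgh (addr_ge0 t0 s0)))//.
      have -> : (fun x => g x + h x + (t + s) * v x) =
                (fun x => (g x + t * v x) + (h x + s * v x)).
        by apply/funext => x; ring.
      have := qD (fun x => g x + t * v x) (fun x => h x + s * v x)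
        (bounded_fctD bg (bounded_fctZ t bv))
        (bounded_fctD bh (bounded_fctZ s bv)).
      lra.
    + rewrite -ler_pdivrMl//; apply: (leV) => t t0; rewrite ler_pdivrMl//.
      rewrite (le_trans (Vle _ (c * t) (bounded_fctZ c bg) _))//.
        by rewrite mulr_ge0// ltW.
      have -> : (fun x => c * g x + c * t * v x) =
                (fun x => c * (g x + t * v x)).
        by apply/funext => x; ring.
      have := qZ c _ c0 (bounded_fctD bg (bounded_fctZ t bv)); lra.
    + by rewrite (le_trans (Vq _ bg))// qs.
  have := qmin _ Vsub Vq _ bf; have := Vle f 1 bf ler01.
  under eq_fun do rewrite mul1r.
  lra.
have qN f : bounded_fct f -> q (fun x => - f x) = - q f.
  move=> bf; have := qadd f _ bf (bounded_fctN bf).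
  have -> : (fun x => f x + - f x) = (fun=> 0).
    by apply/funext => x; rewrite subrr.
  lra.
split=> // c f bf; have [c0|c0|->] := ltgtP c 0.
- have -> : (fun x => c * f x) = (fun x => - (- c * f x)).
    by apply/funext => x; ring.
  rewrite qN; last exact: bounded_fctZ.
  by rewrite sublinearZ ?oppr_gt0//; lra.
- exact: sublinearZ.
- rewrite mul0r -[RHS]q0; congr q.
  by apply/funext => x; rewrite mul0r.
Qed.

(** Minimax in the form of Mazur and Orlicz.  The functional
    [f |-> inf_(h in H, t >= 0) sup (f + t h)] is sublinear because [H] is convex
    up to domination, and finite because the members of [H] have nonnegative
    supremum.  It is at most [0] at [- h], hence so is any linear functional
    below it. *)
Theorem mean_exists H : H !=set0 ->
  (forall h, H h -> bounded_fct h) ->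
  (forall g h s t, H g -> H h -> 0 <= s -> 0 <= t -> s + t = 1 ->
     exists2 k, H k & forall x, k x <= s * g x + t * h x) ->
  (forall h e, H h -> 0 < e -> exists x, - e < h x) ->
  exists2 m, is_mean m & forall h, H h -> 0 <= m h.
Proof.
move=> [h0 Hh0] bH cH sH.
pose V f := [set c : R | exists h t,
  [/\ H h, 0 <= t & forall x, f x + t * h x <= c]].
have lbV f C : (forall x, - C <= f x) -> lbound (V f) (- C).
  move=> fC c [h [t [Hh t0 le]]]; rewrite leNgt; apply/negP => cC.
  have t1 : 0 < t + 1 by lra.
  pose e := (- C - c) / (t + 1).
  have e0 : 0 < e by apply: divr_gt0; lra.
  have te : t * e + e = - C - c by rewrite /e; field; rewrite gt_eqF.
  have [x hx] := sH h e Hh e0.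
  have := ler_wpM2l t0 (ltW hx); have := le x; have := fC x; lra.
have lbVb f : bounded_fct f -> has_lbound (V f).
  move=> [C fC]; exists (- C); apply: lbV => x.
  by have := fC x; rewrite ler_norml => /andP[].
have supV f C : (forall x, f x <= C) -> V f C.
  by move=> fC; exists h0, 0; split=> // x; rewrite mul0r addr0.
have V0 f : bounded_fct f -> V f !=set0.
  move=> [C fC]; exists C; apply: supV => x.
  by have := fC x; rewrite ler_norml => /andP[].
have infV f c : bounded_fct f -> V f c -> inf (V f) <= c.
  by move=> bf Vc; apply: ge_inf => //; exact: lbVb.
have Vsub : sublinear_le_sup (fun f => inf (V f)).
  split=> [f g bf bg|c f c0 bf|f C bf fC].
  + rewrite -lerBlDr; apply: lb_le_inf; first exact: V0.
    move=> c Vc; rewrite lerBlDr -lerBlDl; apply: lb_le_inf; first exact: V0.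
    move=> d Vd; rewrite lerBlDl; apply: infV; first exact: bounded_fctD.
    move: Vc Vd => [h [t [Hh t0 hle]]] [k [s [Hk s0 kle]]].
    have [st0|st0] := eqVneq (t + s) 0.
      exists h, 0; split => // x; have := hle x; have := kle x.
      have -> : t = 0 by lra.
      have -> : s = 0 by lra.
      lra.
    have ts0 : 0 < t + s by lra.
    have [l Hl lle] := cH h k (t / (t + s)) (s / (t + s)) Hh Hk
      (divr_ge0 t0 (ltW ts0)) (divr_ge0 s0 (ltW ts0))
      ltac:(by rewrite -mulrDl divff).
    exists l, (t + s); split => //; first lra.
    move=> x; have := ler_wpM2l (ltW ts0) (lle x).
    have -> : (t + s) * (t / (t + s) * h x + s / (t + s) * k x) =
      t * h x + s * k x by field.
    have := hle x; have := kle x; lra.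
  + rewrite -ler_pdivrMl//; apply: lb_le_inf; first exact: V0.
    move=> d [h [t [Hh t0 hle]]]; rewrite ler_pdivrMl//.
    apply: infV; first exact: bounded_fctZ.
    exists h, (c * t); split => //; first by rewrite mulr_ge0// ltW.
    move=> x; rewrite -mulrA -mulrDr ler_wpM2l//; exact: ltW.
  + by apply: infV => //; exact: supV.
have [m [msub mle] mmin] := minimal_sublinear Vsub.
have mm := minimal_is_mean msub mmin; exists m => // h Hh.
have bh := bH h Hh.
have : m (fun x => -1 * h x) <= 0.
  apply: le_trans (mle _ (bounded_fctZ _ bh)) _.
  apply: infV; first exact: bounded_fctZ.
  by exists h, 1; split => // x; lra.
have [_ -> //] := mm.
lra.
Qed.

Lemma mean_le m f g : is_mean m -> bounded_fct f -> bounded_fct g ->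
  (forall x, f x <= g x) -> m f <= m g.
Proof.
move=> [mD mZ ms] bf bg fg.
have := ms (fun x => f x + -1 * g x) 0 (bounded_fctD bf (bounded_fctZ _ bg)).
rewrite mD ?mZ//; last exact: bounded_fctZ.
move=> /(_ ltac:(move=> x; have := fg x; lra)); lra.
Qed.

Lemma mean_sum m (h : nat -> S -> R) n : is_mean m ->
  (forall k, bounded_fct (h k)) ->
  bounded_fct (fun s => \sum_(0 <= k < n) h k s) /\
  m (fun s => \sum_(0 <= k < n) h k s) = \sum_(0 <= k < n) m (h k).
Proof.
move=> [mD mZ _] bh.
have b0 : bounded_fct (fun _ : S => 0 : R) by exists 0 => s; rewrite normr0.
elim: n => [|n [ihb ihm]].
  under eq_fun do rewrite big_geq//.
  rewrite big_geq//; split => //.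
  by have := mZ 0 _ b0; rewrite !mul0r.
under eq_fun do rewrite big_nat_recr//=.
rewrite big_nat_recr//=; split; first exact: bounded_fctD.
by rewrite mD// ihm.
Qed.

Lemma mean_cst m c : is_mean m -> m (fun=> c) = c.
Proof.
move=> [mD mZ ms].
have b (c' : R) : bounded_fct (fun _ : S => c') by exists `|c'|.
have h c' : m (fun=> c') <= c' by exact: ms.
have := mZ (-1) (fun=> c) (b c); have := h c; have := h (-1 * c); lra.
Qed.

Lemma mean_norm_le m f c : is_mean m -> bounded_fct f ->
  (forall s, `|f s| <= c) -> `|m f| <= c.
Proof.
move=> mm bf fc; have bc (c' : R) : bounded_fct (fun _ : S => c') by exists `|c'|.
rewrite ler_norml -{1}(mean_cst (- c) mm) -{2}(mean_cst c mm).
by apply/andP; split; apply: mean_le => // s;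
  have := fc s; rewrite ler_norml => /andP[].
Qed.

End means.

(** * Integration of functions of linear growth *)

Lemma partial_sum_gt (R : realType) (b : nat -> R) (M d : R) :
  (forall k, 0 <= b k) -> (\sum_(k <oo) (b k)%:E = M%:E)%E -> 0 < d ->
  exists n, M - d < \sum_(0 <= k < n) b k.
Proof.
move=> b0 bM d0; apply: contrapT => /forallNP nh.
have : (\sum_(k <oo) (b k)%:E <= (M - d)%:E)%E.
  apply: lime_le.
    by apply: is_cvg_nneseries => k _ _; rewrite lee_fin.
  by apply: nearW => n; rewrite sumEFin lee_fin leNgt; apply/negP; exact: nh.
by rewrite bM lee_fin; lra.
Qed.

Section functions_of_linear_growth.
Variables (R : realType) (X : completeMetricType R).
Implicit Types (f g u v : X -> R) (mu nu : P1 X) (x y : X).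

Lemma open_borel (U : set X) : open U -> measurable (U : set (borel X)).
Proof. exact: sub_sigma_algebra. Qed.

Lemma ball_borel x (e : R) : measurable (ball x e : set (borel X)).
Proof.
apply: open_borel; rewrite openE => y; rewrite /= ballEmdist/= => xy.
apply/nbhs_ballP; exists (e - mdist x y) => /=; first by rewrite subr_gt0.
move=> z; rewrite !ballEmdist/= => yz.
by rewrite (le_lt_trans (metric_triangle x y z))// -ltrBrDl.
Qed.

Definition lipschitz_with (L : R) f := forall x y, `|f x - f y| <= L * mdist x y.

Lemma lipschitz_measurable L f : lipschitz_with L f ->
  measurable_fun setT (f : borel X -> R).
Proof.
move=> Lf; apply: (measurability _ (RGenOpens.measurableE R)).
move=> _ [_ [a [b ->]] <-]; rewrite setTI; apply: open_borel.
apply: open_comp; last exact: interval_open.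
move=> x _; apply/cvgrPdist_lt => /= e e0.
have L0 : 0 < `|L| + 1 by have := normr_ge0 L; lra.
near=> y.
have : ball x (e / (`|L| + 1)) y.
  by near: y; apply: nbhsx_ballx; rewrite divr_gt0.
rewrite ballEmdist/= ltr_pdivlMr// => xy.
apply: le_lt_trans (Lf x y) _; apply: le_lt_trans xy.
rewrite mulrC ler_wpM2l ?mdist_ge0//; have := ler_norm L; lra.
Unshelve. all: by end_near. Qed.

Lemma lipschitz_mdist x : lipschitz_with 1 (mdist x).
Proof.
move=> y z; rewrite mul1r ler_norml.
have := metric_triangle x y z; have := metric_triangle x z y.
rewrite (metric_sym z y); lra.
Qed.

Definition dist0 x : R := mdist (point : X) x.

Lemma dist0_ge0 x : 0 <= dist0 x. Proof. exact: mdist_ge0. Qed.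

(** Lipschitz functions and indicators of Borel sets have both properties, and
    together they give integrability against every element of [P1 X]. *)
Definition linear_growth u := measurable_fun setT (u : borel X -> R) /\
  exists C, forall x, `|u x| <= C * (1 + dist0 x).

Lemma lipschitz_growth L f : lipschitz_with L f -> linear_growth f.
Proof.
move=> Lf; split; first exact: lipschitz_measurable Lf.
exists (`|L| + `|f point|) => x.
have h1 : `|f x - f point| <= `|L| * dist0 x.
  rewrite (le_trans (Lf x point))// metric_sym.
  by rewrite ler_wpM2r ?mdist_ge0// ler_norm.
have := ler_normD (f x - f point) (f point); rewrite subrK.
have := mulr_ge0 (normr_ge0 (f point)) (dist0_ge0 x).
have := normr_ge0 L; lra.
Qed.

Lemma growthD u v : linear_growth u -> linear_growth v ->
  linear_growth (fun x => u x + v x).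
Proof.
move=> [mu [C hC]] [mv [D hD]]; split; first exact: measurable_funD.
exists (C + D) => x; rewrite (le_trans (ler_normD _ _))// mulrDl lerD//.
Qed.

Lemma growthZ c u : linear_growth u -> linear_growth (fun x => c * u x).
Proof.
move=> [mu [C hC]]; split; first exact: measurable_funM.
by exists (`|c| * C) => x; rewrite normrM -mulrA ler_wpM2l.
Qed.

Lemma growth_cst c : linear_growth (fun=> c).
Proof.
by split=> //; exists `|c| => x; have := mulr_ge0 (normr_ge0 c) (dist0_ge0 x); lra.
Qed.

Lemma growth_indic (A : set (borel X)) : measurable A -> linear_growth (\1_A).
Proof.
move=> mA; split; first exact: measurable_indic.
exists 1 => x; have := dist0_ge0 x; rewrite indicE.
by case: (x \in A); rewrite ?normr0 ?normr1; lra.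
Qed.

Lemma growth_dist0 : linear_growth dist0.
Proof. exact: lipschitz_growth (lipschitz_mdist point). Qed.

Lemma growth_integrable mu u : linear_growth u ->
  mu.-integrable setT (EFin \o (u : borel X -> R)).
Proof.
move=> [mmu [C hC]].
have irad : mu.-integrable setT (EFin \o (dist0 : borel X -> R)).
  apply/integrableP; split; first by apply/measurable_EFinP; case: growth_dist0.
  apply: le_lt_trans (P1_moment mu point); apply: ge0_le_integral => //=.
  - by apply/measurable_EFinP/measurableT_comp => //; case: growth_dist0.
  - by apply/measurable_EFinP; case: growth_dist0.
  - by move=> x _; rewrite lee_fin ger0_norm// dist0_ge0.
have i1 : mu.-integrable setT (EFin \o (fun x : borel X => C * (1 + dist0 x))).
  rewrite (_ : _ \o _ = (fun x => C%:E * (cst 1%E x + (EFin \o dist0) x))%E)//.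
  apply: integrableZl => //; apply: integrableD => //.
  exact: finite_measure_integrable_cst.
apply: le_integrable i1 => //; first exact/measurable_EFinP.
by move=> x _ /=; rewrite lee_fin (le_trans (hC x))// ler_norm.
Qed.

Definition intg mu u : R := \int[mu]_x (u : borel X -> R) x.

Lemma intgE mu u : linear_growth u ->
  (\int[mu]_x (u x)%:E)%E = (intg mu u)%:E.
Proof.
by move=> gu; rewrite fineK//; apply: integrable_fin_num => //;
  exact: growth_integrable.
Qed.

Lemma intgD mu u v : linear_growth u -> linear_growth v ->
  intg mu (fun x => u x + v x) = intg mu u + intg mu v.
Proof. by move=> gu gv; rewrite /intg RintegralD//; exact: growth_integrable. Qed.

Lemma intgZ mu c u : linear_growth u ->
  intg mu (fun x => c * u x) = c * intg mu u.
Proof. by move=> gu; rewrite /intg RintegralZl//; exact: growth_integrable. Qed.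

Lemma intg_cst mu c : intg mu (fun=> c) = c.
Proof. by rewrite /intg Rintegral_cst//= probability_setT mulr1. Qed.

Lemma intg_sum mu (F : nat -> X -> R) n : (forall k, linear_growth (F k)) ->
  linear_growth (fun x => \sum_(0 <= k < n) F k x) /\
  intg mu (fun x => \sum_(0 <= k < n) F k x) = \sum_(0 <= k < n) intg mu (F k).
Proof.
move=> gF; elim: n => [|n [ihg ihi]].
  under eq_fun do rewrite big_geq//.
  by rewrite big_geq// intg_cst; split => //; exact: growth_cst.
under eq_fun do rewrite big_nat_recr//=.
by rewrite big_nat_recr//= intgD// ihi; split => //; exact: growthD.
Qed.

Lemma intg_le mu u v : linear_growth u -> linear_growth v ->
  (forall x, u x <= v x) -> intg mu u <= intg mu v.
Proof.
by move=> gu gv uv; apply: le_Rintegral => //; exact: growth_integrable.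
Qed.

Lemma intg_indic mu (A : set (borel X)) : measurable A ->
  (intg mu (\1_A))%:E = mu A.
Proof.
move=> mA; rewrite -intgE; last exact: growth_indic.
by rewrite integral_indic// setIT.
Qed.

(** The separability of the space is used through these countable partitions,
    which reduce couplings to countable matrices and integrals to finite sums. *)
Definition small_partition (e : R) (z : nat -> X) (A : nat -> set (borel X)) :=
  [/\ forall n, measurable (A n), trivIset setT A, \bigcup_n A n = setT &
      forall n x, A n x -> mdist (z n) x < e].

Lemma dense_seq : separable X -> exists z : nat -> X, dense (range z).
Proof.
move=> [D cD dD]; have [x0 Dx0] : D !=set0.
  by have [x [_ Dx]] := dD setT (ex_intro _ point Logic.I) openT; exists x.
have /pcard_surjP [g gD] : (D #<= [set: nat])%card := cD.
exists g => U U0 oU; have [x [Ux Dx]] := dD U U0 oU.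
have [n _ gn] := gD x Dx; exists x; split=> //; by exists n.
Qed.

Lemma small_partition_exists e : separable X -> 0 < e ->
  exists z A, small_partition e z A.
Proof.
move=> /dense_seq[z dz] e0.
exists z, (seqDU (fun n => ball (z n) e : set (borel X))); split.
- by apply: seqDU_measurable => n; exact: ball_borel.
- exact: trivIset_seqDU.
- rewrite -seqDU_bigcup_eq -subTset => x _.
  have [||y [/=]] := dz (ball x e)°.
  + by exists x; apply: nbhsx_ballx.
  + exact: open_interior.
  + move=> /interior_subset xy [n _ zn]; exists n => //.
    by rewrite zn; exact: ball_sym.
- by move=> n x [+ _]; rewrite ballEmdist.
Qed.

(** Continuity only gives measurability for the Borel sets of the product topology,
    which without separability may exceed the product sigma-algebra.  Along a
    dense sequence [z],
    [mdist x y] is the infimum of [mdist (z n) x + mdist (z n) y], a countable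
    infimum of functions that separate the variables. *)
Lemma mdist_measurable : separable X ->
  measurable_fun setT (fun w : borel X * borel X => mdist (w.1 : X) (w.2 : X)).
Proof.
move=> /dense_seq[z dz].
pose h n (w : borel X * borel X) := mdist (z n) (w.1 : X) + mdist (z n) (w.2 : X).
have mh n : measurable_fun setT (h n).
  by apply: measurable_funD; apply: measurableT_comp => //;
    exact: lipschitz_measurable (lipschitz_mdist (z n)).
have lh w : has_lbound (range (h ^~ w)).
  by exists 0 => _ [n _ <-]; rewrite addr_ge0// mdist_ge0.
rewrite (_ : (fun _ => _) = (fun w => infs (h ^~ w) 0%N)); last first.
  apply/funext => w; rewrite /infs; apply/eqP; rewrite eq_le; apply/andP; split.
    apply: lb_le_inf; first by exists (h 0%N w), 0%N.
    move=> _ [n _ <-]; rewrite /h.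
    by rewrite (metric_sym (z n) w.1) metric_triangle.
  apply/ler_addgt0Pr => e e0.
  have [||y [/= + [n _ zn]]] := dz (ball (w.1 : X) (e / 2))°.
  + by exists w.1; apply: nbhsx_ballx; rewrite divr_gt0.
  + exact: open_interior.
  move=> /interior_subset; rewrite -zn ballEmdist/= => wz.
  apply: (@le_trans _ _ (h n w)).
    apply: ge_inf; last by exists n.
    have [C hC] := lh w; exists C => _ [k _ <-]; apply: hC; by exists k.
  rewrite /h; have := metric_triangle (z n) w.1 w.2.
  rewrite (metric_sym (z n) w.1); lra.
by apply: measurable_fun_infs.
Qed.

End functions_of_linear_growth.
Arguments growth_cst {R X} c.
Arguments growth_dist0 {R X}.

(** * From cell masses to couplings *)

(** A matrix that couples the masses of the cells of a partition refines to a
    coupling of the measures themselves: on each cell [A k * A l] spread the mass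
    [a k l] proportionally to the product measure. *)
Lemma glue_matrix (R : realType) (d : measure_display) (T : measurableType d)
    (mu nu : probability T R) (A : nat -> set T) (a : nat -> nat -> R) :
  (forall n, measurable (A n)) -> trivIset setT A -> \bigcup_n A n = setT ->
  (forall k l, 0 <= a k l) ->
  (forall k, (\sum_(l <oo) (a k l)%:E = mu (A k))%E) ->
  (forall l, (\sum_(k <oo) (a k l)%:E = nu (A l))%E) ->
  exists P : probability (T * T)%type R,
  [/\ forall B, measurable B -> P (B `*` setT) = mu B,
      forall B, measurable B -> P (setT `*` B) = nu B &
      forall (g : T * T -> R) (C : nat -> nat -> R), measurable_fun setT g ->
        (forall w, 0 <= g w) -> (forall k l, 0 <= C k l) ->
        (forall k l x y, A k x -> A l y -> g (x, y) <= C k l) ->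
        (\int[P]_w (g w)%:E <=
           \sum_(k <oo) \sum_(l <oo) (a k l * C k l)%:E)%E].
Proof.
move=> mA tA UA a0 sumr sumc.
pose m k := fine (mu (A k)); pose n l := fine (nu (A l)).
have mE k : mu (A k) = (m k)%:E by rewrite fineK// fin_num_measure.
have nE l : nu (A l) = (n l)%:E by rewrite fineK// fin_num_measure.
have m0 k : 0 <= m k by rewrite fine_ge0.
have n0 l : 0 <= n l by rewrite fine_ge0.
have aE0 k l : (0 <= (a k l)%:E)%E by rewrite lee_fin.
have am k l : a k l <= m k.
  rewrite -lee_fin -mE -sumr.
  have := @nneseries_lim_ge R (fun l => (a k l)%:E) xpredT 0 l.+1 (fun l _ _ => aE0 k l).
  apply: le_trans; rewrite big_nat_recr//= leeDr// sume_ge0//.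
have an k l : a k l <= n l.
  rewrite -lee_fin -nE -sumc.
  have := @nneseries_lim_ge R (fun k => (a k l)%:E) xpredT 0 k.+1 (fun k _ _ => aE0 k l).
  apply: le_trans; rewrite big_nat_recr//= leeDr// sume_ge0//.
(* on a null cell [a k l] vanishes and the value [x / 0 = 0] is the right one *)
pose c k l := a k l / (m k * n l).
have c0 k l : 0 <= c k l by rewrite divr_ge0// mulr_ge0.
have cE k l : c k l * (m k * n l) = a k l.
  have [mn0|mn0] := eqVneq (m k * n l) 0; last by rewrite /c divfK.
  rewrite mn0 mulr0; apply/eqP; rewrite eq_le a0/=.
  by move/eqP : mn0; rewrite mulf_eq0 => /orP[]/eqP <-.
have mAA k l : measurable (A k `*` A l) by exact: measurableX.
pose p : {measure set (T * T) -> \bar R} := (mu \x nu)%E.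
pose P0 k l : {measure set (T * T) -> \bar R} :=
  mscale (NngNum (c0 k l)) (mrestr p (mAA k l)).
pose Prow k : {measure set (T * T) -> \bar R} := mseries (P0 k) 0.
pose P : {measure set (T * T) -> \bar R} := mseries Prow 0.
have P0E k l B B' : measurable B -> measurable B' ->
    P0 k l (B `*` B') =
    (c k l * (fine (mu (B `&` A k)) * fine (nu (B' `&` A l))))%:E.
  move=> mB mB'; rewrite /P0 /= /mscale /= /mrestr /p /= -setXI.
  rewrite product_measure1E; [|exact: measurableI..].
  by rewrite !EFinM !fineK// fin_num_measure//; exact: measurableI.
have part (Q : probability T R) B : measurable B ->
    (\sum_(k <oo) Q (B `&` A k) = Q B)%E.
  move=> mB; rewrite -measure_semi_bigcup -?setI_bigcupr ?UA ?setIT//.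
  - by move=> i; exact: measurableI.
  - exact: trivIset_setIl.
have marg1 B : measurable B -> P (B `*` setT) = mu B.
  move=> mB; rewrite /P /= /mseries -(part mu B mB).
  apply: eq_eseriesr => k _; rewrite /Prow/= /mseries.
  pose b := fine (mu (B `&` A k)).
  have bE : mu (B `&` A k) = b%:E.
    by rewrite fineK// fin_num_measure//; exact: measurableI.
  have bm : b <= m k.
    by rewrite -lee_fin -bE -mE le_measure// inE//; exact: measurableI.
  have b0 : 0 <= b by rewrite fine_ge0.
  transitivity (\sum_(l <oo) (b / m k)%:E * (a k l)%:E)%E.
    apply: eq_eseriesr => l _; rewrite P0E// setTI -/b -/(n l) -EFinM.
    have [mk0|mk0] := eqVneq (m k) 0.
      have -> : b = 0 by apply/eqP; rewrite eq_le b0 -mk0 bm.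
      by congr EFin; ring.
    by congr EFin; rewrite -[in RHS]cE; field.
  rewrite nneseriesZl// sumr mE bE -EFinM; congr EFin.
  have [mk0|mk0] := eqVneq (m k) 0; last by rewrite divfK.
  by rewrite mk0 mulr0; apply/eqP; rewrite eq_le b0 -mk0 bm.
have marg2 B : measurable B -> P (setT `*` B) = nu B.
  move=> mB; rewrite /P /= /mseries -(part nu B mB).
  rewrite [LHS]nneseries_interchange//.
  apply: eq_eseriesr => l _.
  pose b := fine (nu (B `&` A l)).
  have bE : nu (B `&` A l) = b%:E.
    by rewrite fineK// fin_num_measure//; exact: measurableI.
  have bm : b <= n l.
    by rewrite -lee_fin -bE -nE le_measure// inE//; exact: measurableI.
  have b0 : 0 <= b by rewrite fine_ge0.
  transitivity (\sum_(k <oo) (b / n l)%:E * (a k l)%:E)%E.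
    apply: eq_eseriesr => k _; rewrite P0E// setTI -/b -/(m k) -EFinM.
    have [nl0|nl0] := eqVneq (n l) 0.
      have -> : b = 0 by apply/eqP; rewrite eq_le b0 -nl0 bm.
      by congr EFin; ring.
    by congr EFin; rewrite -[in RHS]cE; field.
  rewrite nneseriesZl// sumc nE bE -EFinM; congr EFin.
  have [nl0|nl0] := eqVneq (n l) 0; last by rewrite divfK.
  by rewrite nl0 mulr0; apply/eqP; rewrite eq_le b0 -nl0 bm.
have PT : P setT = 1%E by rewrite -setXTT marg1// probability_setT.
pose isP := Measure_isProbability.Build _ _ _ (mseries Prow 0) PT.
pose PP : probability (T * T)%type R := HB.pack (mseries Prow 0) isP.
exists PP; split => // g C mg g0 C0 gC.
have mg' : measurable_fun setT (EFin \o g) by exact/measurable_EFinP.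
have g0' w : (0 <= (g w)%:E)%E by rewrite lee_fin.
rewrite (_ : (\int[PP]_w _ = \int[P]_w (EFin \o g) w)%E)//.
rewrite [leLHS]ge0_integral_measure_series//; last by move=> w _; exact: g0'.
apply: lee_nneseries => [k _ _|k _]; first by apply: integral_ge0 => w _; exact: g0'.
rewrite [leLHS]ge0_integral_measure_series//; last by move=> w _; exact: g0'.
apply: lee_nneseries => [l _ _|l _]; first by apply: integral_ge0 => w _; exact: g0'.
have -> : (\int[P0 k l]_w (EFin \o g) w =
    (c k l)%:E * \int[mrestr p (mAA k l)]_w (EFin \o g) w)%E.
  by apply: ge0_integral_mscale => //; move=> w _; exact: g0'.
apply: (@le_trans _ _ ((c k l)%:E * ((C k l)%:E * p (A k `*` A l)))%E).
  rewrite lee_wpmul2l ?lee_fin//.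
  have -> : p (A k `*` A l) = mrestr p (mAA k l) setT by rewrite /mrestr setTI.
  rewrite -integral_cst//.
  apply: ae_ge0_le_integral => //.
  - by move=> w _; exact: g0'.
  - by move=> w _; rewrite lee_fin.
  exists (~` (A k `*` A l)); split.
  - exact: measurableC.
  - rewrite /= /mrestr /= setICl; exact: measure0.
  - move=> [x y] /= h [xA yA]; apply: h => _; rewrite lee_fin; exact: gC.
have -> : p (A k `*` A l) = (m k * n l)%:E.
  by rewrite /p/= product_measure1E// EFinM -mE -nE.
by rewrite -!EFinM lee_fin -cE; lra.
Qed.

(** * Kantorovich-Rubinstein duality *)

Section kantorovich_rubinstein.
Variables (R : realType) (X : completeMetricType R).
Implicit Types (f g u v : X -> R) (mu nu : P1 X) (x y : X).

(** The Kantorovich-Rubinstein dual distance.  Unlike [W1] it is visibly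
    homogeneous along segments, which is what convexity arguments need. *)
Definition kr mu nu : R :=
  sup [set intg mu f - intg nu f | f in @lipschitz_with R X 1].

Lemma intgB mu f g : linear_growth f -> linear_growth g ->
  intg mu (fun x => f x - g x) = intg mu f - intg mu g.
Proof.
move=> gf gg; rewrite -mulN1r -intgZ// -intgD//; last exact: growthZ.
by congr intg; apply/funext => x; rewrite mulN1r.
Qed.

Lemma intg_shift mu f c : linear_growth f ->
  intg mu (fun x => f x + c) = intg mu f + c.
Proof. by move=> gf; rewrite intgD// ?intg_cst//; exact: growth_cst. Qed.

Lemma kr_has_ubound mu nu :
  has_ubound [set intg mu f - intg nu f | f in @lipschitz_with R X 1].
Proof.
exists (intg mu (@dist0 R X) + intg nu (@dist0 R X)) => _ [f Lf <-].
have gf := lipschitz_growth Lf; have gr : linear_growth (@dist0 R X) := growth_dist0.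
have h x : `|f x - f point| <= dist0 x.
  by have := Lf x point; rewrite mul1r metric_sym.
have h1 : intg mu f <= intg mu (@dist0 R X) + f point.
  rewrite -intg_shift//; apply: intg_le => //.
    exact: growthD gr (growth_cst _).
  by move=> x; have := h x; rewrite ler_norml => /andP[]; lra.
have h2 : - intg nu (@dist0 R X) + f point <= intg nu f.
  rewrite -mulN1r -intgZ// -intg_shift; last exact: growthZ.
  apply: intg_le => //; first exact: growthD (growthZ _ gr) (growth_cst _).
  by move=> x; have := h x; rewrite ler_norml => /andP[]; lra.
lra.
Qed.

Lemma le_kr mu nu L f : 0 <= L -> lipschitz_with L f ->
  intg mu f - intg nu f <= L * kr mu nu.
Proof.
rewrite le_eqVlt => /predU1P[<-|L0] Lf.
  have -> : f = fun=> f point.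
    apply/funext => x; have := Lf x point; rewrite mul0r normr_le0 subr_eq0.
    by move/eqP.
  by rewrite !intg_cst subrr mul0r.
have gf := lipschitz_growth Lf.
have L1 : lipschitz_with 1 (fun x => L^-1 * f x).
  move=> x y; rewrite -mulrBr normrM gtr0_norm ?invr_gt0//.
  by rewrite ler_pdivrMl// mul1r.
rewrite -ler_pdivrMl// mulrBr -!intgZ//.
by apply: ub_le_sup; [exact: kr_has_ubound|exists (fun x => L^-1 * f x)].
Qed.

Lemma kr_approx mu nu e : 0 < e ->
  exists2 f, lipschitz_with 1 f & kr mu nu - e < intg mu f - intg nu f.
Proof.
move=> e0.
have [|_ [f Lf <-] h] := sup_adherent e0
  (_ : has_sup [set intg mu f - intg nu f | f in @lipschitz_with R X 1]).
  split; last exact: kr_has_ubound.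
  exists (intg mu (fun=> 0) - intg nu (fun=> 0)), (fun=> 0) => // x y.
  by rewrite subrr normr0 mul1r mdist_ge0.
by exists f.
Qed.

Lemma kr_ge0 mu nu : 0 <= kr mu nu.
Proof.
have := @le_kr mu nu 1 (fun=> 0) ler01; rewrite !intg_cst subrr mul1r; apply.
by move=> x y; rewrite subrr normr0 mul1r mdist_ge0.
Qed.

(** Replacing [u] by its transform [g x = sup_x' (u x' - t d(x, x'))] loses
    nothing: [u <= g], [g <= - v], and [g] is [t]-Lipschitz. *)
Lemma kr_weak_duality mu nu u v t : linear_growth u -> linear_growth v ->
  0 <= t -> (forall x y, u x + v y <= t * mdist x y) ->
  intg mu u + intg nu v <= t * kr mu nu.
Proof.
move=> gu gv t0 uv.
pose V x := [set u x' - t * mdist x x' | x' in [set: X]].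
pose g x := sup (V x).
have Vub x : ubound (V x) (- v x).
  by move=> _ [x' _ <-]; have := uv x' x; rewrite (metric_sym x'); lra.
have V0 x : V x !=set0 by exists (u x - t * mdist x x), x.
have Vhub x : has_ubound (V x) by exists (- v x).
have gV x x' : u x' - t * mdist x x' <= g x.
  by apply: ub_le_sup => //; exists x'.
have ug x : u x <= g x by have := gV x x; rewrite mdistxx; lra.
have gv' x : g x <= - v x by apply: ge_sup.
have Lg x y : g x - g y <= t * mdist x y.
  rewrite lerBlDr; apply: ge_sup => // _ [x' _ <-].
  have := gV y x'; have := ler_wpM2l t0 (metric_triangle y x x').
  rewrite (metric_sym y x); lra.
have tg : lipschitz_with t g.
  move=> x y; rewrite ler_norml Lg andbT.
  have := Lg y x; rewrite metric_sym; lra.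
have gg := lipschitz_growth tg.
have := le_kr mu nu t0 tg; have := intg_le mu gu gg ug.
have : intg nu g <= - intg nu v; last lra.
rewrite -mulN1r -intgZ//; apply: intg_le => //; first exact: growthZ.
by move=> x; rewrite mulN1r.
Qed.

(** Dividing by this weight turns functions dominated by it, the distance among
    them, into bounded ones, to which means apply. *)
Definition weight (p : X * X) : R := 1 + dist0 p.1 + dist0 p.2.
Definition dominated (h : X * X -> R) := exists C, forall p, `|h p| <= C * weight p.

Lemma weight_ge1 p : 1 <= weight p.
Proof. by have := dist0_ge0 p.1; have := dist0_ge0 p.2; rewrite /weight; lra. Qed.

Lemma weight_gt0 p : 0 < weight p. Proof. by have := weight_ge1 p; lra. Qed.

Lemma dominatedD h k : dominated h -> dominated k ->
  dominated (fun p => h p + k p).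
Proof.
move=> [C hC] [D hD]; exists (C + D) => p.
by rewrite (le_trans (ler_normD _ _))// mulrDl lerD.
Qed.

Lemma dominatedZ c h : dominated h -> dominated (fun p => c * h p).
Proof. by move=> [C hC]; exists (`|c| * C) => p; rewrite normrM -mulrA ler_wpM2l. Qed.

Lemma dominated_bounded h : dominated h -> bounded_fct (fun p => h p / weight p).
Proof.
move=> [C hC]; exists C => p.
by rewrite normrM normfV (gtr0_norm (weight_gt0 p)) ler_pdivrMr ?weight_gt0.
Qed.

Lemma bounded_dominated h C : (forall p, `|h p| <= C) -> dominated h.
Proof.
move=> hC; exists `|C| => p; apply: le_trans (hC p) _.
apply: le_trans (ler_norm C) _; rewrite ler_peMr//; exact: weight_ge1.
Qed.

Lemma dominated1 u : linear_growth u -> dominated (fun p => u p.1).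
Proof.
move=> [_ [C hC]]; exists `|C| => p; apply: le_trans (hC p.1) _.
have := dist0_ge0 p.1; have := dist0_ge0 p.2 => r2 r1.
apply: (@le_trans _ _ (`|C| * (1 + dist0 p.1))).
  by rewrite ler_wpM2r ?ler_norm//; lra.
by rewrite ler_wpM2l// /weight; lra.
Qed.

Lemma dominated2 u : linear_growth u -> dominated (fun p => u p.2).
Proof.
move=> [_ [C hC]]; exists `|C| => p; apply: le_trans (hC p.2) _.
have := dist0_ge0 p.1; have := dist0_ge0 p.2 => r2 r1.
apply: (@le_trans _ _ (`|C| * (1 + dist0 p.2))).
  by rewrite ler_wpM2r ?ler_norm//; lra.
by rewrite ler_wpM2l// /weight; lra.
Qed.

Lemma dominated_mdist : dominated (fun p => mdist p.1 p.2).
Proof.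
exists 1 => p; rewrite ger0_norm ?mdist_ge0// /weight.
have := metric_triangle p.1 point p.2; rewrite (metric_sym p.1 point) /dist0; lra.
Qed.

(** A coupling of [mu] and [nu] that is only finitely additive on the product,
    given by its integral. *)
Record transport_plan mu nu (l : (X * X -> R) -> R) : Prop := TransportPlan {
  planD : forall h k, dominated h -> dominated k ->
    l (fun p => h p + k p) = l h + l k ;
  planZ : forall c h, dominated h -> l (fun p => c * h p) = c * l h ;
  plan_le : forall h k, dominated h -> dominated k ->
    (forall p, h p <= k p) -> l h <= l k ;
  plan1 : forall u, linear_growth u -> l (fun p => u p.1) = intg mu u ;
  plan2 : forall v, linear_growth v -> l (fun p => v p.2) = intg nu v }.

(** The conditions on a plan (marginals at least [mu] and [nu], cost at most
    [kr mu nu]) are inequalities indexed by [u], [v] and [t], and weak duality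
    says that each of them can be met up to any [e]; a mean then meets all of
    them at once.  Applying the marginal inequalities to opposite functions turns
    them into equalities. *)
Lemma transport_plan_exists mu nu :
  exists2 l, transport_plan mu nu l & l (fun p => mdist p.1 p.2) <= kr mu nu.
Proof.
(* the integral of [weight] against any coupling of [mu] and [nu] *)
pose W := 1 + intg mu (@dist0 R X) + intg nu (@dist0 R X).
have gr : linear_growth (@dist0 R X) := growth_dist0.
have W0 : 0 < W.
  have rad0 k : 0 <= intg k (@dist0 R X).
    by rewrite -(intg_cst k 0); apply: intg_le => //; [exact: growth_cst|exact: dist0_ge0].
  by have := rad0 mu; have := rad0 nu; rewrite /W; lra.
pose dom u v t p := u p.1 + v p.2 - t * mdist p.1 p.2.
pose cst u v t := (t * kr mu nu - intg mu u - intg nu v) / W.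
pose Hf u v t p := dom u v t p / weight p + cst u v t.
pose H : set (X * X -> R) := [set h | exists u v t,
  [/\ linear_growth u, linear_growth v, 0 <= t & h = Hf u v t]].
have ddom u v t : linear_growth u -> linear_growth v -> dominated (dom u v t).
  move=> gu gv; rewrite (_ : dom _ _ _ =
    fun p => (u p.1 + v p.2) + (- t) * mdist p.1 p.2); last first.
    by apply/funext => p; rewrite mulNr.
  apply: dominatedD; last exact: dominatedZ dominated_mdist.
  by apply: dominatedD; [exact: dominated1|exact: dominated2].
have g0 : linear_growth (fun _ : X => 0) := growth_cst 0.
have [||||m mm mH] := @mean_exists R (X * X)%type H.
- by exists (Hf (fun=> 0) (fun=> 0) 0), (fun=> 0), (fun=> 0), 0.
- move=> _ [u [v [t [gu gv t0 ->]]]]; apply: bounded_fctD.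
    exact: dominated_bounded (ddom _ _ _ gu gv).
  by exists `|cst u v t|.
- move=> _ _ a b [u [v [t [gu gv t0 ->]]]] [u' [v' [t' [gu' gv' t'0 ->]]]] a0 b0 _.
  exists (Hf (fun x => a * u x + b * u' x) (fun x => a * v x + b * v' x)
    (a * t + b * t')).
    do 3 eexists; split; last reflexivity.
    + by apply: growthD; exact: growthZ.
    + by apply: growthD; exact: growthZ.
    + by rewrite addr_ge0// mulr_ge0.
  move=> p; rewrite /Hf /dom /cst !intgD ?intgZ//; try exact: growthZ.
  by rewrite le_eqVlt; apply/orP; left; apply/eqP; ring.
- move=> _ e [u [v [t [gu gv t0 ->]]]] e0; apply: contrapT => /forallNP nh.
  (* were [Hf u v t <= - e] everywhere, [s * weight] could be split between [u]
     and [v], against weak duality *)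
  pose s := cst u v t + e.
  have uv x y : (u x + s * (1 + dist0 x)) + (v y + s * dist0 y) <= t * mdist x y.
    have /negP := nh (x, y); rewrite -leNgt /Hf -lerBrDr ler_pdivrMr ?weight_gt0//.
    rewrite /dom /weight /s/=; lra.
  have gur : linear_growth (fun x => s * (1 + dist0 x)).
    by apply: growthZ; apply: growthD => //; exact: growth_cst.
  have gvr : linear_growth (fun x => s * dist0 x) by exact: growthZ.
  have := @kr_weak_duality mu nu _ _ t (growthD gu gur) (growthD gv gvr) t0 uv.
  rewrite !intgD ?intgZ ?intgD ?intg_cst//; try exact: growth_cst; last first.
    by apply: growthD => //; exact: growth_cst.
  have : s * W = (t * kr mu nu - intg mu u - intg nu v) + e * W.
    by rewrite /s /cst mulrDl divfK ?gt_eqF.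
  have := mulr_gt0 e0 W0; rewrite /W; lra.
have [mD mZ ms] := mm.
pose l (h : X * X -> R) := W * m (fun p => h p / weight p).
have lD h k : dominated h -> dominated k -> l (fun p => h p + k p) = l h + l k.
  move=> dh dk; have bh := dominated_bounded dh; have bk := dominated_bounded dk.
  rewrite /l -mulrDr -(mD _ _ bh bk).
  by congr (_ * m _); apply/funext => p; rewrite mulrDl.
have lZ c h : dominated h -> l (fun p => c * h p) = c * l h.
  move=> dh; rewrite /l mulrCA -(mZ c _ (dominated_bounded dh)).
  by congr (_ * m _); apply/funext => p; rewrite mulrA.
have key u v t : linear_growth u -> linear_growth v -> 0 <= t ->
    intg mu u + intg nu v - t * kr mu nu <= l (dom u v t).
  move=> gu gv t0; have := mH (Hf u v t); rewrite /Hf.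
  rewrite (mD _ _ (dominated_bounded (ddom _ _ t gu gv))); last first.
    by exists `|cst u v t|.
  rewrite (mean_cst _ mm) => h; have {h} : 0 <= m (fun p => dom u v t p / weight p) + cst u v t.
    by apply: h; exists u, v, t.
  move=> /(ler_wpM2l (ltW W0)); rewrite mulr0 mulrDr -/(l _) /cst.
  by rewrite (mulrC W) divfK ?gt_eqF//; lra.
have domE u v : dom u v 0 = fun p => u p.1 + v p.2.
  by apply/funext => p; rewrite /dom mul0r subr0.
have l1le u : linear_growth u -> intg mu u <= l (fun p => u p.1).
  move=> gu; have := key u _ 0 gu g0 (lexx 0); rewrite domE intg_cst mul0r.
  by under eq_fun do rewrite addr0; lra.
have l2le u : linear_growth u -> intg nu u <= l (fun p => u p.2).
  move=> gu; have := key _ u 0 g0 gu (lexx 0); rewrite domE intg_cst mul0r.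
  by under eq_fun do rewrite add0r; lra.
exists l; first split => //.
- move=> h k dh dk hk; rewrite /l ler_wpM2l//; first exact: ltW.
  apply: (mean_le mm (dominated_bounded dh) (dominated_bounded dk)) => p.
  by rewrite ler_wpM2r// invr_ge0 ltW// weight_gt0.
- move=> u gu; apply/eqP; rewrite eq_le l1le// andbT.
  have := l1le _ (growthZ (-1) gu); rewrite lZ ?intgZ//; last exact: dominated1.
  lra.
- move=> u gu; apply/eqP; rewrite eq_le l2le// andbT.
  have := l2le _ (growthZ (-1) gu); rewrite lZ ?intgZ//; last exact: dominated2.
  lra.
- have := key _ _ 1 g0 g0 ler01; rewrite !intg_cst.
  have -> : dom (fun=> 0) (fun=> 0) 1 = fun p => -1 * mdist p.1 p.2.
    by apply/funext => p; rewrite /dom; ring.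
  by rewrite lZ; [lra|exact: dominated_mdist].
Qed.


Lemma partition_index e z A : small_partition e z A ->
  exists kappa : X -> nat, forall n x, A n x <-> kappa x = n.
Proof.
move=> [_ tA UA _].
have h x : exists n, A n x by have : setT x by []; rewrite -UA => -[n _ Anx]; exists n.
exists (fun x => projT1 (cid (h x))) => n x; case: cid => k Ak /=; split => [An|<-//].
by apply: (tA k n) => //; exists x.
Qed.

Lemma sum_indic (A : nat -> set X) (kappa : X -> nat) (F : nat -> R) n x :
  (forall n x, A n x <-> kappa x = n) ->
  \sum_(0 <= k < n) \1_(A k) x * F k = if (kappa x < n)%N then F (kappa x) else 0.
Proof.
move=> AE; have iE k : \1_(A k) x = (kappa x == k)%:R :> R.
  rewrite indicE; congr (_%:R); congr nat_of_bool.
  by apply/idP/eqP => [/set_mem/AE|/AE/mem_set].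
elim: n => [|n ih]; first by rewrite big_geq.
rewrite big_nat_recr//= ih iE ltnS [(kappa x <= n)%N]leq_eqVlt.
have [<-|] := eqVneq (kappa x) n; first by rewrite ltnn mul1r add0r.
by rewrite mul0r addr0.
Qed.

Lemma plan_swap mu nu l : transport_plan mu nu l ->
  transport_plan nu mu (fun h => l (fun p => h (p.2, p.1))).
Proof.
have dsw (h : X * X -> R) : dominated h -> dominated (fun p => h (p.2, p.1)).
  move=> [C hC]; exists C => p; apply: le_trans (hC _) _.
  by rewrite /weight /= addrAC.
move=> [lD lZ lle l1 l2]; split.
- by move=> h k dh dk; rewrite lD//; exact: dsw.
- by move=> c h dh; rewrite lZ//; exact: dsw.
- by move=> h k dh dk hk; apply: lle; [exact: dsw..|].
- exact: l2.
- exact: l1.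
Qed.

Lemma dominated_cst c : dominated (fun=> c).
Proof. exact: (@bounded_dominated _ `|c|). Qed.

Lemma plan_sum mu nu l n (h : nat -> X * X -> R) : transport_plan mu nu l ->
  (forall i, dominated (h i)) ->
  dominated (fun p => \sum_(0 <= i < n) h i p) /\
  l (fun p => \sum_(0 <= i < n) h i p) = \sum_(0 <= i < n) l (h i).
Proof.
move=> pl dh; elim: n => [|n [ihd ihl]].
  under eq_fun do rewrite big_geq//.
  rewrite big_geq//; split; first exact: dominated_cst.
  by have := planZ pl 0 (dominated_cst 0); rewrite !mul0r.
under eq_fun do rewrite big_nat_recr//=.
rewrite big_nat_recr//=; split; first exact: dominatedD.
by rewrite (planD pl)// ihl.
Qed.

Lemma plan_indic_ge0 mu nu l (A B : set (borel X)) : transport_plan mu nu l ->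
  dominated (fun p : X * X => \1_A p.1 * \1_B p.2 : R) /\
  0 <= l (fun p => \1_A p.1 * \1_B p.2).
Proof.
move=> pl; have d : dominated (fun p : X * X => \1_A p.1 * \1_B p.2 : R).
  apply: (@bounded_dominated _ 1) => p; rewrite !indicE -natrM normr_nat.
  by case: (_ \in _); case: (_ \in _); rewrite ?ler01 ?lexx.
split => //; have := planZ pl 0 (dominated_cst 0); rewrite !mul0r => <-.
by apply: (plan_le pl) => //; exact: dominated_cst.
Qed.

(** Countable additivity is inherited from the marginals: the mass that a plan
    puts in the cells [A k * A j] with [j >= n] is at most the [nu]-mass of
    the tail of the partition, which tends to [0]. *)
Lemma plan_row mu nu l e z A k : transport_plan mu nu l ->
  small_partition e z A ->
  (\sum_(j <oo) (l (fun p => \1_(A k) p.1 * \1_(A j) p.2))%:E = mu (A k))%E.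
Proof.
move=> pl sA; have [mA tA UA _] := sA; have [kappa AE] := partition_index sA.
pose pi j : R := l (fun p => \1_(A k) p.1 * \1_(A j) p.2).
have pi0 j : 0 <= pi j by have [] := plan_indic_ge0 (A k) (A j) pl.
pose h j (p : X * X) : R := \1_(A k) p.1 * \1_(A j) p.2.
have dh j : dominated (h j) by have [] := plan_indic_ge0 (A k) (A j) pl.
pose q n y : R := 1 - \sum_(0 <= j < n) \1_(A j) y.
have qE n y : q n y = if (kappa y < n)%N then 0 else 1.
  have := @sum_indic A kappa (fun=> 1) n y AE; rewrite /q.
  under eq_bigr do rewrite mulr1.
  by move=> ->; case: ifP => _; rewrite ?subrr ?subr0.
have gs n := intg_sum nu n (fun j => growth_indic (mA j)).
(* [q n] is the indicator of the tail of the partition *)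
have gq n : linear_growth (q n).
  rewrite (_ : q n = fun y => (fun=> 1) y + -1 * \sum_(0 <= j < n) \1_(A j) y).
    by apply: growthD; [exact: growth_cst|apply: growthZ; have [] := gs n].
  by apply/funext => y; rewrite /q mulN1r.
have iq n : intg nu (q n) = 1 - \sum_(0 <= j < n) intg nu (\1_(A j)).
  have [g1 g2] := gs n.
  by rewrite -g2 -(intg_cst nu 1) -intgB//; exact: growth_cst.
have gAk : linear_growth (\1_(A k) : X -> R) by exact: growth_indic.
have up n : \sum_(0 <= j < n) pi j <= intg mu (\1_(A k)).
  have [d <-] := plan_sum n pl dh; rewrite -(plan1 pl)//.
  apply: (plan_le pl) => // [|p]; first exact: dominated1.
  rewrite /h -mulr_sumr -[leRHS]mulr1 ler_wpM2l//.
  by have := qE n p.2; rewrite /q; case: ifP => _; lra.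
have lo n : intg mu (\1_(A k)) <= \sum_(0 <= j < n) pi j + intg nu (q n).
  have [d <-] := plan_sum n pl dh; rewrite -(plan1 pl)// -(plan2 pl)//.
  rewrite -(planD pl)//; last exact: dominated2.
  apply: (plan_le pl) => // [||p]; first exact: dominated1.
    by apply: dominatedD => //; exact: dominated2.
  rewrite /h -mulr_sumr.
  have -> : \sum_(0 <= j < n) \1_(A j) p.2 = 1 - q n p.2.
    by rewrite /q; lra.
  rewrite qE indicE; case: ifP; case: (_ \in _) => /=; lra.
rewrite -intg_indic//; apply/eqP; rewrite eq_le; apply/andP; split.
  apply: lime_le; first by apply: is_cvg_nneseries => n _ _; rewrite lee_fin; exact: pi0.
  by apply: nearW => n; rewrite sumEFin lee_fin; exact: up.
apply/lee_addgt0Pr => d d0.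
have nuA0 j : 0 <= intg nu (\1_(A j)) by rewrite -lee_fin intg_indic.
have nuA1 : (\sum_(j <oo) (intg nu (\1_(A j)))%:E = 1%:E)%E.
  under eq_eseriesr do rewrite intg_indic//.
  rewrite -measure_semi_bigcup ?UA//; exact: probability_setT.
have [n hn] := partial_sum_gt nuA0 nuA1 d0.
have := @nneseries_lim_ge R (fun j => (pi j)%:E) xpredT 0 n
  ltac:(by move=> *; rewrite lee_fin).
move=> /(leeD2r d%:E); apply: le_trans; rewrite sumEFin -EFinD lee_fin.
by have := lo n; rewrite iq; lra.
Qed.

Lemma plan_column mu nu l e z A k : transport_plan mu nu l ->
  small_partition e z A ->
  (\sum_(j <oo) (l (fun p => \1_(A j) p.1 * \1_(A k) p.2))%:E = nu (A k))%E.
Proof.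
move=> /plan_swap pl sA; rewrite -(plan_row k pl sA).
by apply: eq_eseriesr => j _; congr (_%:E); congr l; apply/funext => p; rewrite mulrC.
Qed.

(** Strong duality.  The masses that a finitely additive plan gives to the cells
    of a fine partition form an honest coupling of the cell masses, and refining
    that matrix changes the cost by at most a multiple of the mesh. *)
Theorem W1_le_kr mu nu : separable X -> (W1 mu nu <= (kr mu nu)%:E)%E.
Proof.
move=> sX; apply/lee_addgt0Pr => e e0; rewrite -EFinD.
have e4 : 0 < e / 4 by lra.
have [z [A sA]] := small_partition_exists sX e4.
have [mA tA UA zA] := sA; have [kappa AE] := partition_index sA.
have [l pl lcost] := transport_plan_exists mu nu.
pose a k j := l (fun p => \1_(A k) p.1 * \1_(A j) p.2).
have a0 k j : 0 <= a k j by have [] := plan_indic_ge0 (A k) (A j) pl.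
have [P [Pfst Psnd Pint]] := glue_matrix mA tA UA a0
  (fun k => plan_row k pl sA) (fun k => plan_column k pl sA).
pose C k j := mdist (z k) (z j) + 2 * (e / 4).
have C0 k j : 0 <= C k j by have := mdist_ge0 (z k) (z j); rewrite /C; lra.
have mf : measurable_fun setT (fst : borel X * borel X -> borel X) by [].
have ms : measurable_fun setT (snd : borel X * borel X -> borel X) by [].
pose Yf : {mfun (borel X * borel X)%type >-> borel X} :=
  HB.pack (fst : borel X * borel X -> borel X) (isMeasurableFun.Build _ _ _ _ _ mf).
pose Zf : {mfun (borel X * borel X)%type >-> borel X} :=
  HB.pack (snd : borel X * borel X -> borel X) (isMeasurableFun.Build _ _ _ _ _ ms).
pose cost : \bar R := (\int[P]_w (mdist (w.1 : X) (w.2 : X))%:E)%E.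
apply: (@le_trans _ _ cost).
  apply: ereal_inf_lbound.
  exists _, _, P, Yf, Zf; split => //.
  - move=> B mB; rewrite -Pfst//= /distribution /pushforward /=.
    by congr (P _); apply/seteqP; split => [[x y]//|[x y] []].
  - move=> B mB; rewrite -Psnd//= /distribution /pushforward /=.
    by congr (P _); apply/seteqP; split => [[x y]//|[x y] []].
have zxy k j x y : A k x -> A j y ->
    mdist x y <= C k j /\ C k j <= mdist x y + e.
  move=> /zA xz /zA yz; rewrite /C; split.
    have := metric_triangle x (z k) y; have := metric_triangle (z k) (z j) y.
    rewrite (metric_sym x (z k)); lra.
  have := metric_triangle (z k) x (z j); have := metric_triangle x y (z j).
  rewrite (metric_sym y (z j)); lra.
apply: (le_trans (Pint (fun w => mdist (w.1 : X) (w.2 : X)) C _ _ C0 _)).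
- exact: mdist_measurable.
- by move=> w; exact: mdist_ge0.
- by move=> k j x y Ax Ay; have [] := zxy k j x y Ax Ay.
have aC0 k j : (0 <= (a k j * C k j)%:E)%E by rewrite lee_fin mulr_ge0.
have fin N M : \sum_(0 <= k < N) \sum_(0 <= j < M) a k j * C k j <= kr mu nu + e.
  pose h k j (p : X * X) : R := C k j * (\1_(A k) p.1 * \1_(A j) p.2).
  have dh k j : dominated (h k j).
    by apply: dominatedZ; have [] := plan_indic_ge0 (A k) (A j) pl.
  have hE k : \sum_(0 <= j < M) a k j * C k j =
      l (fun p => \sum_(0 <= j < M) h k j p).
    have [_ ->] := plan_sum M pl (dh k); apply: eq_bigr => j _.
    by rewrite mulrC (planZ pl)//; have [] := plan_indic_ge0 (A k) (A j) pl.
  under eq_bigr do rewrite hE.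
  have dd := dominated_mdist; have de := dominated_cst e.
  have [d <-] := plan_sum N pl (fun k => (plan_sum M pl (dh k)).1).
  have le1 : l (fun=> e) = e by rewrite (plan1 pl (growth_cst e)) intg_cst.
  apply: (@le_trans _ _ (l (fun p => mdist p.1 p.2 + e))); last first.
    by rewrite (planD pl)// le1; lra.
  apply: (plan_le pl) => // [|p]; first exact: dominatedD.
  have -> : \sum_(0 <= k < N) \sum_(0 <= j < M) h k j p =
    \sum_(0 <= k < N) \1_(A k) p.1 *
      (\sum_(0 <= j < M) \1_(A j) p.2 * C k j).
    apply: eq_bigr => k _; rewrite mulr_sumr; apply: eq_bigr => j _.
    by rewrite /h; ring.
  rewrite (sum_indic _ _ _ AE).
  have d0 : 0 <= mdist p.1 p.2 + e by rewrite addr_ge0 ?mdist_ge0// ltW.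
  case: ifP => // _; rewrite (sum_indic _ _ _ AE); case: ifP => // _.
  by have [] := zxy (kappa p.1) (kappa p.2) p.1 p.2 (proj2 (AE _ _) erefl)
    (proj2 (AE _ _) erefl).
apply: lime_le.
  by apply: is_cvg_nneseries => k _ _; apply: nneseries_ge0 => j _ _.
apply: nearW => N; rewrite -nneseries_sum_nat//.
apply: lime_le.
  by apply: is_cvg_nneseries => j _ _; rewrite sume_ge0.
apply: nearW => M; rewrite exchange_big/=.
under eq_bigr do rewrite sumEFin.
by rewrite sumEFin lee_fin.
Qed.

End kantorovich_rubinstein.

(** * Lipschitz minorants of convex functionals *)

Section affine_minorants.
Variables (R : realType) (X : completeMetricType R).
Implicit Types (f g u v : X -> R) (mu nu : P1 X) (x y : X).

Lemma mixture_exists t mu nu : 0 <= t <= 1 -> exists2 tau, is_mixture t mu nu tau &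
  forall u, linear_growth u -> intg tau u = t * intg mu u + (1 - t) * intg nu u.
Proof.
move=> /andP[t0 t1]; have t1' : 0 <= 1 - t by lra.
pose M : {measure set (borel X) -> \bar R} :=
  measure_add (mscale (NngNum t0) mu) (mscale (NngNum t1') nu).
have ME A : (M A = t%:E * mu A + (1 - t)%:E * nu A)%E.
  exact: measure_addE.
have Mint (g : X -> R) : measurable_fun setT (g : borel X -> R) ->
    (forall x, 0 <= g x) ->
    (\int[M]_x (g x)%:E = t%:E * \int[mu]_x (g x)%:E +
                          (1 - t)%:E * \int[nu]_x (g x)%:E)%E.
  move=> mg g0; have mg' : measurable_fun setT (EFin \o (g : borel X -> R)).
    exact/measurable_EFinP.
  have g0' (x : borel X) : setT x -> (0 <= (EFin \o g) x)%E.
    by move=> _; rewrite lee_fin.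
  have := ge0_integral_measure_add (mscale (NngNum t0) mu) (mscale (NngNum t1') nu)
    measurableT g0' mg'.
  rewrite (ge0_integral_mscale mu measurableT (NngNum t0) mg' g0').
  by rewrite (ge0_integral_mscale nu measurableT (NngNum t1') mg' g0').
have MT : M setT = 1%E.
  have PT (k : P1 X) : k setT = 1%E by exact: probability_setT.
  by rewrite ME !PT !mule1 -EFinD; congr EFin; ring.
pose m_ n : {measure set (borel X) -> \bar R} :=
  if n is 0%N then mscale (NngNum t0) mu else mscale (NngNum t1') nu.
pose isP := Measure_isProbability.Build _ _ _ (msum m_ 2) MT.
pose P : probability (borel X) R := HB.pack (msum m_ 2) isP.
have Pm (x0 : X) : (\int[P]_x (mdist x0 (x : X))%:E < +oo)%E.
  rewrite [ltLHS](Mint (mdist x0)).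
  - have gd : linear_growth (mdist x0) := lipschitz_growth (lipschitz_mdist x0).
    by rewrite !intgE// -!EFinM -EFinD ltry.
  - exact: lipschitz_measurable (lipschitz_mdist x0).
  - exact: mdist_ge0.
exists (MkP1 Pm) => [A mA|u gu]; first exact: ME.
have ge0E g : linear_growth g -> (forall x, 0 <= g x) ->
    intg (MkP1 Pm) g = t * intg mu g + (1 - t) * intg nu g.
  move=> gg g0; apply: EFin_inj; rewrite -intgE// EFinD !EFinM -!intgE//.
  by apply: Mint => //; case: gg.
(* [u] becomes nonnegative after adding a multiple of [1 + dist0] *)
have [_ [C uC]] := gu.
pose g x := `|C| * (1 + dist0 x).
have g0 x : 0 <= g x by rewrite mulr_ge0// addr_ge0// dist0_ge0.
have gg : linear_growth g.
  by apply: growthZ; apply: growthD; [exact: growth_cst|exact: growth_dist0].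
have ug0 x : 0 <= u x + g x.
  have : - u x <= g x; last lra.
  rewrite /g (le_trans (ler_norm _))// normrN (le_trans (uC x))//.
  by rewrite ler_wpM2r ?ler_norm// addr_ge0// dist0_ge0.
have := ge0E _ gg g0; have := ge0E _ (growthD gu gg) ug0.
rewrite !intgD//; lra.
Qed.

(** Fixing the value at the base point makes evaluations and integrals bounded
    functions of [f]. *)
Definition pinned : Type := {f : X -> R | lipschitz_with 1 f /\ f point = 0}.

Lemma pinned_le (s : pinned) x : `|sval s x| <= dist0 x.
Proof.
case: s => f [Lf f0] /=; have := Lf x point.
by rewrite f0 subr0 mul1r metric_sym.
Qed.

Lemma pinned_growth (s : pinned) : linear_growth (sval s).
Proof. by case: s => f [Lf f0] /=; exact: lipschitz_growth Lf. Qed.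

Lemma intg_dist0_le mu u : linear_growth u -> (forall x, `|u x| <= dist0 x) ->
  `|intg mu u| <= intg mu (@dist0 R X).
Proof.
move=> gu ur; have gr := @growth_dist0 R X; rewrite ler_norml; apply/andP; split.
  rewrite -mulN1r -intgZ//; apply: intg_le => //; first exact: growthZ.
  by move=> x; have := ur x; rewrite ler_norml => /andP[]; rewrite mulN1r.
by apply: intg_le => // x; have := ur x; rewrite ler_norml => /andP[].
Qed.

(** A finitely supported approximation of [nu] that works for all 1-Lipschitz
    functions simultaneously.  On the small cells the Lipschitz bound controls the
    error, and on the tail of the partition the first moment of [nu] does. *)
Lemma quantization nu e : separable X -> 0 < e ->
  exists n (z : nat -> X) (c : nat -> R), forall s : pinned,
    `|intg nu (sval s) - \sum_(0 <= k < n) c k * sval s (z k)| <= e.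
Proof.
move=> sX e0; have e2 : 0 < e / 2 by lra.
have [z [A sA]] := small_partition_exists sX e2.
have [mA tA UA zA] := sA; have [kappa AE] := partition_index sA.
have gr := @growth_dist0 R X.
pose F k x : R := \1_(A k) x * dist0 x.
have F0 k x : 0 <= F k x by rewrite mulr_ge0// dist0_ge0.
have gF k : linear_growth (F k).
  split.
    apply: measurable_funM; first exact: measurable_indic.
    by have [] := gr.
  exists 1 => x; rewrite ger0_norm// /F indicE; have := dist0_ge0 x.
  by case: (_ \in _) => /=; lra.
have FE k : (intg nu (F k))%:E = (\int[nu]_(x in A k) (dist0 x)%:E)%E.
  rewrite -intgE// [RHS]integral_mkcond; apply: eq_integral => x _.
  by rewrite patchE /F indicE; case: (_ \in _); rewrite ?mul1r ?mul0r.
have sF : (\sum_(k <oo) (intg nu (F k))%:E = (intg nu (@dist0 R X))%:E)%E.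
  under eq_eseriesr do rewrite FE.
  rewrite -intgE// -ge0_integral_bigcup ?UA//.
  - by apply/measurable_EFinP; have [] := gr.
  - by move=> x _; rewrite lee_fin dist0_ge0.
have iF0 k : 0 <= intg nu (F k).
  by rewrite -(intg_cst nu 0); apply: intg_le => //; exact: growth_cst.
have [n hn] := partial_sum_gt iF0 sF e2.
exists n, z, (fun k => intg nu (\1_(A k))) => s.
have gs := pinned_growth s.
have gG k : linear_growth (fun x => sval s (z k) * \1_(A k) x).
  by apply: growthZ; exact: growth_indic.
have [gsF isF] := intg_sum nu n gF; have [gsG isG] := intg_sum nu n gG.
have -> : \sum_(0 <= k < n) intg nu (\1_(A k)) * sval s (z k) =
    intg nu (fun x => \sum_(0 <= k < n) sval s (z k) * \1_(A k) x).
  rewrite isG; apply: eq_bigr => k _; rewrite intgZ 1?mulrC//.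
  exact: growth_indic.
rewrite -intgB//.
pose B x := e / 2 + (dist0 x + -1 * \sum_(0 <= k < n) F k x).
have gB : linear_growth B.
  by apply: growthD; [exact: growth_cst|apply: growthD => //; exact: growthZ].
have iB : intg nu B <= e.
  rewrite intgD ?intg_cst; [|exact: growth_cst|by apply: growthD => //; exact: growthZ].
  rewrite intgD ?intgZ//; last exact: growthZ.
  rewrite isF; lra.
have gd : linear_growth
    (fun x => sval s x - \sum_(0 <= k < n) sval s (z k) * \1_(A k) x).
  under eq_fun do rewrite -mulN1r.
  by apply: growthD => //; exact: growthZ.
have dB x : `|sval s x - \sum_(0 <= k < n) sval s (z k) * \1_(A k) x| <= B x.
  under eq_bigr do rewrite mulrC.
  rewrite (sum_indic _ _ _ AE) /B /F (sum_indic (fun=> dist0 x) _ _ AE).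
  case: ifP => _; last by have := pinned_le s x; rewrite subr0; lra.
  have [Lf _] := svalP s.
  have := Lf x (z (kappa x)); have := zA _ x (proj2 (AE _ _) erefl).
  rewrite metric_sym; lra.
apply: le_trans iB; rewrite ler_norml; apply/andP; split.
  rewrite -mulN1r -intgZ//; apply: intg_le => //; first exact: growthZ.
  by move=> x; have := dB x; rewrite ler_norml => /andP[]; rewrite mulN1r.
by apply: intg_le => // x; have := dB x; rewrite ler_norml => /andP[].
Qed.

(** A mean is only finitely additive, so it need not commute with integration in
    general; here it does, because integrals of pinned functions are uniform
    limits of finite combinations of evaluations. *)
Lemma barycenter (m : (pinned -> R) -> R) : separable X -> is_mean m ->
  let fbar x := m (fun s => sval s x) in
  [/\ lipschitz_with 1 fbar, fbar point = 0 &
      forall nu, m (fun s => intg nu (sval s)) = intg nu fbar].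
Proof.
move=> sX mm fbar; have [mD mZ ms] := mm.
have bx x : bounded_fct (fun s : pinned => sval s x).
  by exists (dist0 x) => s; exact: pinned_le.
have bi nu : bounded_fct (fun s : pinned => intg nu (sval s)).
  exists (intg nu (@dist0 R X)) => s.
  by apply: intg_dist0_le; [exact: pinned_growth|exact: pinned_le].
have mB (f g : pinned -> R) : bounded_fct f -> bounded_fct g ->
    m (fun s => f s - g s) = m f - m g.
  move=> bf bg; rewrite -mulN1r -mZ// -mD//; last exact: bounded_fctZ.
  by congr m; apply/funext => s; rewrite mulN1r.
have Lbar : lipschitz_with 1 fbar.
  move=> x y; rewrite /fbar -mB//; apply: mean_norm_le => //.
    by apply: bounded_fctD => //; exact: bounded_fctN.
  by move=> s; have [Lf _] := svalP s; exact: Lf.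
have bar0 : fbar point = 0.
  rewrite -[RHS](mean_cst 0 mm) /fbar; congr m; apply/funext => s.
  by have [] := svalP s.
split => // nu; apply/eqP; rewrite -subr_eq0 -normr_le0.
apply/ler_addgt0Pr => e e0; rewrite add0r.
have e2 : 0 < e / 2 by lra.
have [n [z [c hc]]] := quantization nu sX e2.
have bz k : bounded_fct (fun s : pinned => c k * sval s (z k)) by exact: bounded_fctZ.
have [bS mS] := mean_sum n mm bz.
have h1 : `|intg nu fbar - \sum_(0 <= k < n) c k * fbar (z k)| <= e / 2.
  exact: (hc (exist _ fbar (conj Lbar bar0))).
have h2 : `|m (fun s => intg nu (sval s)) - \sum_(0 <= k < n) c k * fbar (z k)| <= e / 2.
  have -> : \sum_(0 <= k < n) c k * fbar (z k) =
      m (fun s => \sum_(0 <= k < n) c k * sval s (z k)).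
    by rewrite mS; apply: eq_bigr => k _; rewrite mZ.
  rewrite -mB//; apply: mean_norm_le => //.
  by apply: bounded_fctD => //; exact: bounded_fctN.
move: h1 h2; rewrite !ler_norml; lra.
Qed.

(** By definition of [kr], for every single [nu] some 1-Lipschitz [f] makes
    [a + K (int f dnu - int f dmu)] at most [phi nu] up to any error.  Convexity
    of [phi] allows the minimax principle to choose a mean of such functions that
    serves all [nu], and the barycenter of that mean is again 1-Lipschitz. *)
Theorem affine_minorant (phi : P1 X -> \bar R) mu a K : separable X ->
  P1_convex phi -> (forall nu, (-oo < phi nu)%E) ->
  (exists nu, phi nu \is a fin_num) -> 0 <= K ->
  (forall nu, ((a - K * kr mu nu)%:E <= phi nu)%E) ->
  exists2 f, Lip f &
    (forall nu, ((intg nu f)%:E <= phi nu)%E) /\ a <= intg mu f.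
Proof.
move=> sX cvx phiNy [nu0 fin0] K0 lo.
pose h nu (s : pinned) :=
  fine (phi nu) - a + K * (intg mu (sval s) - intg nu (sval s)).
pose H : set (pinned -> R) := [set h nu | nu in [set nu | phi nu \is a fin_num]].
have bi nu : bounded_fct (fun s : pinned => intg nu (sval s)).
  exists (intg nu (@dist0 R X)) => s.
  by apply: intg_dist0_le; [exact: pinned_growth|exact: pinned_le].
have bK nu : bounded_fct (fun s : pinned =>
    K * (intg mu (sval s) - intg nu (sval s))).
  by apply: bounded_fctZ; apply: bounded_fctD => //; exact: bounded_fctN.
have bc (c : R) : bounded_fct (fun _ : pinned => c) by exists `|c|.
have [||||m mm mH] := @mean_exists R pinned H.
- by exists (h nu0), nu0.
- by move=> _ [nu _ <-]; exact: bounded_fctD.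
- move=> _ _ p q [nu /= fn <-] [nu' /= fn' <-] p0 q0 pq.
  have p01 : 0 <= p <= 1 by lra.
  have [tau mtau itau] := mixture_exists nu nu' p01.
  have := cvx p nu nu' tau p01 mtau.
  rewrite -(fineK fn) -(fineK fn') -!EFinM -EFinD => le.
  have ft : phi tau \is a fin_num.
    by rewrite fin_numElt phiNy (le_lt_trans le) ?ltry.
  exists (h tau); first by exists tau.
  move=> s; rewrite /h itau; last exact: pinned_growth.
  move: le; rewrite -(fineK ft) lee_fin.
  have -> : q = 1 - p by lra.
  lra.
- move=> _ e [nu /= fn <-] e0.
  (* an error [d] with [K * d < e], also when [K] is zero *)
  have d0 : 0 < e / (K + 1) by rewrite divr_gt0//; lra.
  have [f Lf fk] := kr_approx mu nu d0.
  have gf := lipschitz_growth Lf.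
  have Lg : lipschitz_with 1 (fun x => f x + - f point).
    by move=> x y; rewrite opprD addrACA subrr addr0; exact: Lf.
  exists (exist _ (fun x => f x + - f point) (conj Lg (subrr _))).
  rewrite /h /= !intg_shift//.
  have := lo nu; rewrite -(fineK fn) lee_fin.
  have : K * (kr mu nu - e / (K + 1)) <= K * (intg mu f - intg nu f).
    by rewrite ler_wpM2l// ltW.
  have : K * (e / (K + 1)) + e / (K + 1) = e by field; rewrite gt_eqF; lra.
  lra.
have [Lb b0 bint] := barycenter sX mm.
set fbar := (fun x => m _) in Lb b0 bint.
have gb := lipschitz_growth Lb.
exists (fun x => K * fbar x + (a - K * intg mu fbar)).
  exists K => x y; rewrite opprD addrACA subrr addr0 -mulrBr normrM ger0_norm//.
  by rewrite ler_wpM2l// -[leRHS]mul1r.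
have iE nu : intg nu (fun x => K * fbar x + (a - K * intg mu fbar)) =
    K * intg nu fbar + (a - K * intg mu fbar).
  by rewrite intg_shift ?intgZ//; exact: growthZ.
split; last by rewrite iE; lra.
move=> nu; have [fn|] := boolP (phi nu \is a fin_num); last first.
  by rewrite fin_numElt phiNy/= -leNgt leye_eq => /eqP ->; rewrite leey.
have [mD mZ _] := mm.
have := mH (h nu) (ex_intro2 _ _ nu fn erefl).
rewrite /h mD// mean_cst// mZ; last first.
  by apply: bounded_fctD => //; exact: bounded_fctN.
rewrite mD//; last exact: bounded_fctN.
have -> : m (fun s => - intg nu (sval s)) = - intg nu fbar.
  rewrite -bint -mulN1r -mZ//; congr m; apply/funext => s; by rewrite mulN1r.
rewrite bint iE -(fineK fn) lee_fin; lra.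
Qed.

End affine_minorants.

(** * The dual representation *)

Section duality.
Variables (R : realType) (X : completeMetricType R).
Implicit Types (f g u v : X -> R) (mu nu : P1 X) (x y : X).
Variable phi : P1 X -> \bar R.
Hypotheses (sepX : separable X) (phi_convex : P1_convex phi).
Hypotheses (phi_lsc : W1_lower_semicontinuous phi).
Hypothesis phi_gtNy : forall mu : P1 X, (-oo < phi mu)%E.
Hypothesis phi_proper : exists mu0 : P1 X, phi mu0 \is a fin_num.

Lemma phi_finVpinfty mu : phi mu \is a fin_num \/ phi mu = +oo%E.
Proof.
have [fn|] := boolP (phi mu \is a fin_num); first by left.
by rewrite fin_numElt phi_gtNy/= -leNgt leye_eq => /eqP; right.
Qed.

Lemma lsc_kr mu (a : R) : (a%:E < phi mu)%E ->
  exists2 e : R, 0 < e & forall nu, kr mu nu < e -> (a%:E < phi nu)%E.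
Proof.
move=> /phi_lsc[e e0 he]; exists e => // nu ke; apply: he.
by rewrite (le_lt_trans (W1_le_kr _ _ sepX))// lte_fin.
Qed.

Lemma kr_mixture mu nu tau t : 0 <= t ->
  (forall u, linear_growth u ->
    intg tau u = t * intg nu u + (1 - t) * intg mu u) ->
  kr mu tau <= t * kr mu nu.
Proof.
move=> t0 tauE; rewrite leNgt; apply/negP => lt.
have [f Lf hf] := kr_approx mu tau (ltac:(lra) : 0 < kr mu tau - t * kr mu nu).
have := ler_wpM2l t0 (le_kr mu nu ler01 Lf).
rewrite tauE in hf; last exact: lipschitz_growth Lf.
lra.
Qed.

(** Around a point [mu0] of the domain [phi] is above [phi mu0 - 1] on a ball of
    radius [e].  Outside of that ball, convexity on the segment from [mu0] to
    [nu], which crosses the ball, bounds the decrease of [phi] linearly in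
    [kr mu0 nu]. *)
Lemma minorant_exists : exists2 f, Lip f & forall nu, ((intg nu f)%:E <= phi nu)%E.
Proof.
have [mu0 fin0] := phi_proper.
pose a := fine (phi mu0) - 1.
have aphi : (a%:E < phi mu0)%E.
  by rewrite -(fineK fin0) lte_fin /a; lra.
have [e e0 he] := lsc_kr aphi.
have K0 : 0 <= 2 / e by rewrite divr_ge0// ltW.
have [|f Lf [fphi _]] := @affine_minorant R X phi mu0 a (2 / e) sepX phi_convex
  phi_gtNy phi_proper K0; last by exists f.
move=> nu; have [fn|->] := phi_finVpinfty nu; last exact: leey.
have [ke|ke] := ltP (kr mu0 nu) e.
  apply: le_trans (ltW (he _ ke)); rewrite lee_fin.
  by have := mulr_ge0 K0 (kr_ge0 mu0 nu); lra.
pose r := kr mu0 nu; have r0 : 0 < r by exact: lt_le_trans ke.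
(* the point of the segment at distance at most [e / 2] from [mu0] *)
pose t := e / (2 * r).
have t0 : 0 < t by rewrite divr_gt0// mulr_gt0.
have t1 : t <= 1 by rewrite ler_pdivrMr ?mulr_gt0// mul1r; rewrite /r; lra.
have [tau mtau itau] := mixture_exists nu mu0 (ltac:(lra) : 0 <= t <= 1).
have ktau : kr mu0 tau < e.
  apply: le_lt_trans (kr_mixture (ltW t0) itau) _.
  have -> : t * kr mu0 nu = e / 2 by rewrite /t -/r; field; rewrite gt_eqF.
  lra.
have := lt_le_trans (he _ ktau)
  (phi_convex (ltac:(lra) : 0 <= t <= 1) mtau).
rewrite -(fineK fn) -(fineK fin0) -!EFinM -EFinD lte_fin lee_fin.
have -> : fine (phi mu0) = a + 1 by rewrite /a; lra.
move=> h; rewrite -(ler_pM2l t0).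
have : t * (2 / e * kr mu0 nu) = 1.
  by rewrite /t -/r; field; rewrite !gt_eqF.
lra.
Qed.

(** The value [phi mu] may be infinite, so the segment argument is not available
    at [mu]; instead the global minorant [f0] controls [phi] outside of the ball on
    which [phi] exceeds [a]. *)
Lemma minorant_near mu (a : R) : (a%:E < phi mu)%E ->
  exists2 f, Lip f &
    (forall nu, ((intg nu f)%:E <= phi nu)%E) /\ a <= intg mu f.
Proof.
move=> aphi; have [e e0 he] := lsc_kr aphi.
have [f0 [L0 Lf0] f0phi] := minorant_exists.
have Lf : lipschitz_with `|L0| f0.
  by move=> x y; rewrite (le_trans (Lf0 x y))// ler_wpM2r ?mdist_ge0// ler_norm.
pose c := `|a - intg mu f0| / e.
have c0 : 0 <= c by rewrite divr_ge0// ltW.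
apply: (@affine_minorant R X phi mu a (`|L0| + c)) => //.
  by rewrite addr_ge0.
move=> nu; have k0 := kr_ge0 mu nu.
have kL := mulr_ge0 (normr_ge0 L0) k0; have kc := mulr_ge0 c0 k0.
have [ke|ke] := ltP (kr mu nu) e.
  by apply: le_trans (ltW (he _ ke)); rewrite lee_fin; lra.
apply: le_trans (f0phi nu); rewrite lee_fin.
have := le_kr mu nu (normr_ge0 L0) Lf.
have : `|a - intg mu f0| <= c * kr mu nu.
  by rewrite /c mulrAC ler_pdivlMr// ler_wpM2l.
have := ler_norm (a - intg mu f0); lra.
Qed.

Lemma Lip_growth f : Lip f -> linear_growth f.
Proof. by move=> [L /lipschitz_growth]. Qed.

Lemma calNbar_le f mu : calNbar phi f -> (\int[mu]_x (f x)%:E <= phi mu)%E.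
Proof.
move=> [Lf rf]; have [fn|->] := phi_finVpinfty mu; last exact: leey.
rewrite -sube_le0; apply: le_trans rf; apply: ereal_sup_ubound.
by exists mu.
Qed.

(** Subtracting the constant [rho f <= 0] from a minorant [f] makes [rho] vanish
    and does not decrease the integral. *)
Lemma calN_near mu (a : R) : (a%:E < phi mu)%E ->
  exists2 f, calN phi f & (a%:E <= \int[mu]_x (f x)%:E)%E.
Proof.
move=> /minorant_near[f Lf [fphi af]]; have gf := Lip_growth Lf.
have [mu0 fin0] := phi_proper.
pose V := [set intg nu f - fine (phi nu) | nu in [set nu | phi nu \is a fin_num]].
have Vub : ubound V 0.
  move=> _ [nu /= fn <-]; have := fphi nu; rewrite -(fineK fn) lee_fin; lra.
have V0 : V !=set0 by exists (intg mu0 f - fine (phi mu0)), mu0.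
have supV : has_sup V by split => //; exists 0.
(* [rho phi f] as a real number: infinite values of [phi] do not contribute *)
pose r := sup V.
have r0 : r <= 0 by exact: ge_sup.
have Lg : Lip (fun x => f x + - r).
  by case: Lf => L Lf; exists L => x y; rewrite opprD addrACA subrr addr0; exact: Lf.
have gg := Lip_growth Lg.
exists (fun x => f x + - r); last first.
  by rewrite intgE// lee_fin intg_shift//; lra.
split => //; apply/eqP; rewrite eq_le; apply/andP; split.
  apply: ge_ereal_sup => _ [nu _ <-]; rewrite intgE// intg_shift//.
  have [fn|->] := phi_finVpinfty nu; last by rewrite leNye.
  rewrite -(fineK fn) -EFinB lee_fin.
  have : intg nu f - fine (phi nu) <= r.
    by apply: ub_le_sup; [case: supV|exists nu].
  lra.
apply/lee_addgt0Pr => e e0.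
have [_ [nu /= fn <-] h] := sup_adherent e0 supV.
have : (\int[nu]_x (f x + - r)%R%:E - phi nu <= rho phi (fun x => f x + - r)%R)%E.
  by apply: ereal_sup_ubound; exists nu.
move=> /(leeD2r e%:E); apply: le_trans.
rewrite intgE// intg_shift// -(fineK fn) -EFinB -EFinD lee_fin.
move: h; rewrite -/r; lra.
Qed.

Lemma le_of_lt_fin (x y : \bar R) : (-oo < x)%E ->
  (forall a : R, (a%:E < x)%E -> (a%:E <= y)%E) -> (x <= y)%E.
Proof.
case: x => [x| |] // _ h; last first.
  by have -> : y = +oo%E by apply/eqyP => A A0; apply: h; rewrite ltry.
apply/lee_addgt0Pr => e e0; rewrite -leeBlDr//; apply: h.
by rewrite lte_fin; lra.
Qed.

End duality.

Theorem corollary1p4 (R : realType) (X : completeMetricType R)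
  (sepX : separable X) (phi : P1 X -> \bar R)
  (phi_convex : P1_convex phi)
  (phi_lsc : W1_lower_semicontinuous phi)
  (phi_gtNy : forall mu : P1 X, (-oo < phi mu)%E)
  (phi_proper : exists mu0 : P1 X, phi mu0 \is a fin_num) :
  forall mu : P1 X,
    phi mu = ereal_sup [set (\int[mu]_x (f x)%:E)%E | f in calN phi] /\
    phi mu = ereal_sup [set (\int[mu]_x (f x)%:E)%E | f in calNbar phi].
Proof.
move=> mu.
have sub : calN phi `<=` calNbar phi by move=> f [Lf rf]; split; rewrite ?rf.
have le1 : (phi mu <= ereal_sup [set (\int[mu]_x (f x)%:E)%E | f in calN phi])%E.
  apply: le_of_lt_fin => // a.
  move=> /(calN_near sepX phi_convex phi_lsc phi_gtNy phi_proper)[f Nf af].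
  by apply: le_trans af _; apply: ereal_sup_ubound; exists f.
have le2 : (ereal_sup [set (\int[mu]_x (f x)%:E)%E | f in calN phi] <=
    ereal_sup [set (\int[mu]_x (f x)%:E)%E | f in calNbar phi])%E.
  by apply: ereal_sup_le => _ [f /sub Nf <-]; exists f.
have le3 : (ereal_sup [set (\int[mu]_x (f x)%:E)%E | f in calNbar phi] <= phi mu)%E.
  by apply: ge_ereal_sup => _ [f Nf <-]; exact: calNbar_le.
split; apply/eqP; rewrite eq_le.
  by rewrite le1 (le_trans le2 le3).
by rewrite le3 (le_trans le1 le2).
Qed.
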